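(* Let $(\mathcal P, Z,\equiv)$ be a standard ordered metric plane. Let $a,b,c,d,m,n,s,p,o$ be points such that: (1) $\neg L(abc)$; (2) $Z(amc)$ and $Z(anb)$; (3) $ad\equiv ab$ and ($Z(adc)$ or $Z(acd)$ or $d=c$); (4) $sb\equiv sd$, $Z(bsm)$ and $Z(csn)$; (5) $bm\equiv cn$; (6) $M(mpn)$ and $M(boc)$. Then $ab\equiv ac$.
   Context: The structure consists of a set $\mathcal P$ of points, a ternary relation $Z$ ($Z(abc)$: ''$b$ lies strictly between $a$ and $c$'') and a quaternary relation $\equiv$ ($ab\equiv cd$: ''$ab$ is congruent to $cd$''). Abbreviations: $\lambda(abc):\Leftrightarrow Z(abc)\vee Z(bca)\vee Z(cab)$; $L(abc):\Leftrightarrow \lambda(abc)\vee a=b\vee b=c\vee c=a$; $M(abc):\Leftrightarrow Z(abc)\wedge ba\equiv bc$ (''$b$ is the midpoint of $ac$''). A standard ordered metric plane is a structure satisfying the following axioms (universally quantified over free variables). (A0) There exist $a,b,c$ with $\neg L(abc)$. (A1) $Z(abc)\rightarrow Z(cba)$. (A2) $Z(abc)\rightarrow\neg Z(acb)$. (A3) $\lambda(abc)\wedge(\lambda(abd)\vee b=d)\rightarrow(\lambda(cda)\vee c=d)$. (A4) If $\neg L(abc)$, $Z(adb)$, $\neg L(abe)$, $c\ne e$ and $\neg\lambda(cde)$, then there is $f$ with $(Z(afc)\vee Z(bfc))\wedge(\lambda(edf)\vee f=e)$. (A5) $ab\equiv pq\wedge ab\equiv rs\rightarrow pq\equiv rs$.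 (A6) $ab\equiv cc\rightarrow a=b$. (A7) $ab\equiv ba\wedge aa\equiv bb$. (A8) If $\lambda(abc)$ and $ab\equiv a'b'$, then there is exactly one $c'$ with $\lambda(a'b'c')$, $ac\equiv a'c'$ and $bc\equiv b'c'$. (A9) If $\neg L(abx)$, $L(abc)$, $L(a'b'c')$, $ab\equiv a'b'$, $bc\equiv b'c'$, $ac\equiv a'c'$, $ax\equiv a'x'$ and $bx\equiv b'x'$, then $xc\equiv x'c'$. (A10) If $\neg L(abx)$, then there is exactly one $x'$ with $x'\neq x$, $ax\equiv ax'$ and $bx\equiv bx'$. (A11) If $\neg L(abx)$, $x'\ne x$, $ax\equiv ax'$ and $bx\equiv bx'$, then there is $y$ with $L(aby)$ and $Z(xyx')$. (A12) If $Z(aoa')$, $oa\equiv oa'$, $ba\equiv ba'$, $o\neq b$, $\lambda(abc)$, $Z(bcb')$, $cb\equiv cb'$ and $ob\equiv ob'$, then $Z(acb)$. *)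

(* Defs.v *)
Set Implicit Arguments.
Unset Strict Implicit.

Section OrderedMetricPlane.

Variables (P : Type) (Z : P -> P -> P -> Prop) (cong : P -> P -> P -> P -> Prop).

(* [Z a b c]: b lies strictly between a and c; [cong a b c d]: ab is congruent
   to cd. *)

Definition lam (a b c : P) : Prop := Z a b c \/ Z b c a \/ Z c a b.

Definition L (a b c : P) : Prop := lam a b c \/ a = b \/ b = c \/ c = a.

Definition midpoint (a b c : P) : Prop := Z a b c /\ cong b a b c.

(* [altitude_foot_between] says: if the angle aob is right, the foot c of the
   perpendicular from o to the line ab (b' is the mirror image of b in oc) lies
   between a and b. *)
Record standard_ordered_metric_plane : Prop := {
  dimension_ge2 : exists a b c, ~ L a b c;
  between_sym : forall a b c, Z a b c -> Z c b a;
  between_asym : forall a b c, Z a b c -> ~ Z a c b;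
  collinear_trans : forall a b c d,
    lam a b c /\ (lam a b d \/ b = d) -> lam c d a \/ c = d;
  pasch : forall a b c d e,
    ~ L a b c -> Z a d b -> ~ L a b e -> c <> e -> ~ lam c d e ->
    exists f, (Z a f c \/ Z b f c) /\ (lam e d f \/ f = e);
  cong_trans : forall a b p q r s, cong a b p q /\ cong a b r s -> cong p q r s;
  cong_eq : forall a b c, cong a b c c -> a = b;
  cong_flip : forall a b, cong a b b a /\ cong a a b b;
  cong_transport : forall a b c a' b',
    lam a b c -> cong a b a' b' ->
    exists! c', lam a' b' c' /\ cong a c a' c' /\ cong b c b' c';
  five_segment : forall a b c x a' b' c' x',
    ~ L a b x -> L a b c -> L a' b' c' ->
    cong a b a' b' -> cong b c b' c' -> cong a c a' c' ->
    cong a x a' x' -> cong b x b' x' -> cong x c x' c';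
  reflection_unique : forall a b x,
    ~ L a b x -> exists! x', x' <> x /\ cong a x a x' /\ cong b x b x';
  reflection_crosses : forall a b x x',
    ~ L a b x -> x' <> x -> cong a x a x' -> cong b x b x' ->
    exists y, L a b y /\ Z x y x';
  altitude_foot_between : forall a o a' b c b',
    Z a o a' -> cong o a o a' -> cong b a b a' -> o <> b ->
    lam a b c -> Z b c b' -> cong c b c b' -> cong o b o b' -> Z a c b
}.

End OrderedMetricPlane.

(* Main.v *)
(** Reflection in the bisector as takes b to d. Suppose that ab < ac, that is, d lies
    between a and c. Then sb < sc, because s lies on the same side of the perpendicular
    bisector of bc as a and b; with bm = cn this yields that bn < cm (hinge theorem).
    On the other hand the angle abm = ads exceeds acn. Completing the parallelogram
    b n b' m with centre p, one has nb' = bm = cn, so the base angles of the triangle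
    nb'c are equal, and removing from them nb'm = abm and ncm = acn leaves a smaller
    angle at b' than at c in the triangle mb'c; hence cm < mb' = bn, a contradiction.

    Segments cannot be laid off freely in these planes. Therefore vx < vy is
    expressed by the side of the mirror of x and y on which v lies; it implies that x
    lies inside all tangents of the circle around v through y, which is what makes these
    comparisons transitive. Two angles at different vertices are compared by
    translating along a common line, using that a line is disjoint from its translate. *)

From Stdlib Require Import Classical ClassicalEpsilon FunctionalExtensionality
  PropExtensionality Lia List.
Require Import Defs.

(** The axioms give less than they suggest. (A8) copies a point only from line to line and controls
    collinearity, not order. So density, perpendiculars at a given point, extension of a segment by
    its own length, and the fact that reflections preserve order all have to be derived before
    motions are available. Without a parallel axiom there are no angle sums, and angles never occur
    as objects: equal angles are corresponding parts under a motion, and an inequality of angles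
    becomes the question which segment a line must cross. Vectors are replaced by the theorem that
    three point reflections with collinear centres compose to a fourth; it serves both to move a
    vertex along a line and to rewrite a glide. The remaining case, d beyond c, needs no new
    argument: the mirror image of c in the line as takes over the role of d once b and c, and m and
    n, are exchanged. *)

Section MetricPlane.

Set Implicit Arguments.
Unset Strict Implicit.

Variables (P : Type) (Z : P -> P -> P -> Prop) (cong : P -> P -> P -> P -> Prop).
Hypothesis HP : standard_ordered_metric_plane Z cong.

Notation L := (L Z).
Notation lam := (lam Z).

(** * Collinearity, congruence classes and points determined by distances *)

Lemma Z_sym a b c : Z a b c -> Z c b a.
Proof. exact (between_sym HP (a:=a) (b:=b) (c:=c)). Qed.

Lemma Z_asym a b c : Z a b c -> ~ Z a c b.
Proof. exact (between_asym HP (a:=a) (b:=b) (c:=c)). Qed.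

Lemma Z_neq12 a b c : Z a b c -> a <> b.
Proof. intros H ->. apply Z_sym in H. exact (Z_asym H H). Qed.

Lemma Z_neq23 a b c : Z a b c -> b <> c.
Proof. intros H ->. exact (Z_asym H H). Qed.

Lemma lam_perm a b c : lam a b c ->
  lam a c b /\ lam b a c /\ lam b c a /\ lam c a b /\ lam c b a.
Proof. unfold lam. pose proof (@Z_sym). intuition auto. Qed.

Lemma L_perm a b c : L a b c ->
  L a c b /\ L b a c /\ L b c a /\ L c a b /\ L c b a.
Proof.
unfold L. intros [H|H].
- apply lam_perm in H. tauto.
- intuition auto.
Qed.

Lemma Z_L a b c : Z a b c -> L a b c.
Proof. intros H. left. left. exact H. Qed.

Lemma L_aab a b : L a a b.
Proof. right; left; reflexivity. Qed.
Lemma L_aba a b : L a b a.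
Proof. right; right; right; reflexivity. Qed.
Lemma L_baa a b : L b a a.
Proof. right; right; left; reflexivity. Qed.

Lemma L_trans1 a b c d : a <> b -> L a b c -> L a b d -> L a c d.
Proof.
intros ab H1 H2.
destruct (classic (c = a)) as [->|ca]; [apply L_aab|].
destruct (classic (d = a)) as [->|da]; [apply L_aba|].
destruct (classic (c = d)) as [->|cd]; [apply L_baa|].
destruct H1 as [H1|[H1|[H1|H1]]]; try congruence.
destruct H2 as [H2|[H2|[H2|H2]]]; try congruence.
- destruct (collinear_trans HP (conj H1 (or_introl H2))) as [H|H]; [|congruence].
  apply lam_perm in H. left; tauto.
- destruct (collinear_trans HP (conj H1 (or_intror H2))) as [H|H]; [|congruence].
  apply lam_perm in H. left; tauto.
Qed.

Lemma L_line a b x y z : a <> b -> L a b x -> L a b y -> L a b z -> L x y z.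
Proof.
intros ab Hx Hy Hz.
destruct (classic (x = a)) as [->|xa]; [exact (L_trans1 ab Hy Hz)|].
assert (H1 := L_trans1 ab Hx Hy). assert (H2 := L_trans1 ab Hx Hz).
apply (@L_trans1 x a); [exact xa|apply L_perm in H1; tauto|apply L_perm in H2; tauto].
Qed.

Lemma L132 a b c : L a b c -> L a c b.
Proof. intros H. apply (L_perm H). Qed.
Lemma L213 a b c : L a b c -> L b a c.
Proof. intros H. apply (L_perm H). Qed.
Lemma L231 a b c : L a b c -> L b c a.
Proof. intros H. apply (L_perm H). Qed.
Lemma L312 a b c : L a b c -> L c a b.
Proof. intros H. apply (L_perm H). Qed.
Lemma L321 a b c : L a b c -> L c b a.
Proof. intros H. apply (L_perm H). Qed.

Ltac Lbase :=
  lazymatch goal with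
  | |- L ?a ?a ?b => apply L_aab
  | |- L ?a ?b ?a => apply L_aba
  | |- L ?b ?a ?a => apply L_baa
  | H : L ?a ?b ?c |- L ?a ?b ?c => exact H
  | |- L ?a ?b ?c =>
     match goal with
     | H : L a c b |- _ => exact (L132 H)
     | H : L b a c |- _ => exact (L213 H)
     | H : L b c a |- _ => exact (L312 H)
     | H : L c a b |- _ => exact (L231 H)
     | H : L c b a |- _ => exact (L321 H)
     | H : Z a b c |- _ => exact (Z_L H)
     | H : Z a c b |- _ => exact (L132 (Z_L H))
     | H : Z b a c |- _ => exact (L213 (Z_L H))
     | H : Z b c a |- _ => exact (L312 (Z_L H))
     | H : Z c a b |- _ => exact (L231 (Z_L H))
     | H : Z c b a |- _ => exact (L321 (Z_L H))
     end
  end.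

(* Proves a collinearity by means of two points known to be distinct. *)
Ltac col :=
  first [ Lbase
  | match goal with
    | H : ?a <> ?b |- L ?x ?y ?z => apply (@L_line a b x y z); [exact H|Lbase|Lbase|Lbase]
    | H : Z ?a ?b ?c |- L ?x ?y ?z =>
       apply (@L_line a b x y z); [exact (Z_neq12 H)|Lbase|Lbase|Lbase]
    | H : Z ?b ?a ?c |- L ?x ?y ?z =>
       apply (@L_line a c x y z); [exact (Z_neq23 H)|Lbase|Lbase|Lbase]
    end ].

Ltac col2 :=
  first [ col
  | match goal with
    | H : ?a <> ?b |- L ?x ?y ?z =>
       apply (@L_line a b x y z); [exact H|solve [col]|solve [col]|solve [col]]
    end ].

Lemma off_line a b : a <> b -> exists x, ~ L a b x.
Proof.
intros ab. apply NNPP. intros H.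
destruct (dimension_ge2 HP) as [u [v [w N]]]. apply N.
assert (H' : forall x, L a b x).
{ intros x. apply NNPP. intros Hx. apply H. exists x; exact Hx. }
apply (L_line ab); apply H'.
Qed.

(* [len a b] is the congruence class of the segment ab, so that congruences
   become equations. *)
Definition len (a b : P) : P -> P -> Prop := fun c d => cong a b c d.

Lemma cong_refl a b : cong a b a b.
Proof.
pose proof (proj1 (cong_flip HP b a)) as H. exact (cong_trans HP (conj H H)).
Qed.

Lemma lenP a b c d : len a b = len c d <-> cong a b c d.
Proof.
split; intros H.
- change (len a b c d). rewrite H. apply cong_refl.
- extensionality x. extensionality y. apply propositional_extensionality.
  assert (H' : cong c d a b) by exact (cong_trans HP (conj H (cong_refl a b))).
  unfold len. split; intros K.
  + exact (cong_trans HP (conj H K)).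
  + exact (cong_trans HP (conj H' K)).
Qed.

Lemma len_sym a b : len a b = len b a.
Proof. apply lenP. exact (proj1 (cong_flip HP a b)). Qed.

Lemma len_eq a b c : len a b = len c c -> a = b.
Proof. rewrite lenP. apply (cong_eq HP). Qed.

Lemma len_refl a b : len a a = len b b.
Proof. apply lenP. exact (proj2 (cong_flip HP a b)). Qed.

Ltac pose_sym x y :=
  match goal with
  | _ : len x y = len y x |- _ => fail 1
  | _ : len y x = len x y |- _ => fail 1
  | _ => pose proof (len_sym x y)
  end.

(* Congruence closure modulo [len a b = len b a]. *)
Ltac cg :=
  repeat match goal with
  | |- context [len ?x ?y] => pose_sym x y
  | _ : context [len ?x ?y] |- _ => pose_sym x y
  end; congruence.

Lemma transport a b c a' b' : lam a b c -> len a b = len a' b' ->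
  exists c', lam a' b' c' /\ len a c = len a' c' /\ len b c = len b' c'.
Proof.
intros H1 H2. rewrite lenP in H2.
destruct (cong_transport HP H1 H2) as [c' [[K1 [K2 K3]] _]].
exists c'. rewrite !lenP. tauto.
Qed.

Lemma transport_unique a b c a' b' c1 c2 : lam a b c -> len a b = len a' b' ->
  lam a' b' c1 -> len a c = len a' c1 -> len b c = len b' c1 ->
  lam a' b' c2 -> len a c = len a' c2 -> len b c = len b' c2 -> c1 = c2.
Proof.
rewrite !lenP. intros H1 H2 A1 A2 A3 B1 B2 B3.
destruct (cong_transport HP H1 H2) as [c' [_ K]].
rewrite <- (K c1), <- (K c2); tauto.
Qed.

Lemma five_segments a b c x a' b' c' x' :
  ~ L a b x -> L a b c -> L a' b' c' ->
  len a b = len a' b' -> len b c = len b' c' -> len a c = len a' c' ->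
  len a x = len a' x' -> len b x = len b' x' -> len c x = len c' x'.
Proof.
intros A B C. rewrite (len_sym c x), (len_sym c' x'), !lenP.
intros. eapply (five_segment HP); eauto.
Qed.

Lemma refl_ex a b x : ~ L a b x ->
  exists x', x' <> x /\ len a x = len a x' /\ len b x = len b x'.
Proof.
intros H. destruct (reflection_unique HP H) as [x' [K _]].
exists x'. rewrite !lenP. exact K.
Qed.

Lemma refl_unique a b x x1 x2 : ~ L a b x ->
  x1 <> x -> len a x = len a x1 -> len b x = len b x1 ->
  x2 <> x -> len a x = len a x2 -> len b x = len b x2 -> x1 = x2.
Proof.
intros H. destruct (reflection_unique HP H) as [x' [_ K]]. rewrite !lenP.
intros. rewrite <- (K x1), <- (K x2); tauto.
Qed.

Lemma refl_crosses a b x x' : ~ L a b x -> x' <> x ->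
  len a x = len a x' -> len b x = len b x' -> exists y, L a b y /\ Z x y x'.
Proof. rewrite !lenP. apply (reflection_crosses HP). Qed.

(** [Z a b a] would make [lam a a b] true, and uniqueness in (A8), applied to the degenerate pair a,
    a, would identify b with its mirror image b' in a line ax not containing b. *)
Lemma Z_degenerate a b : ~ Z a b a.
Proof.
intros H.
destruct (off_line (Z_neq12 H)) as [x Hx].
destruct (@refl_ex a x b) as [b' [N [E _]]]. { intros K; apply Hx; col. }
destruct (@transport a b a a b') as [c' [K1 [K2 K3]]]; [left; exact H|exact E|].
assert (a = c') by (apply (@len_eq a c' a); cg). subst c'.
apply N.
apply (@transport_unique a a b a a); unfold Defs.lam in *; auto.
destruct K1 as [K1|[K1|K1]]; auto.
Qed.

Lemma Z_neq13 a b c : Z a b c -> a <> c.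
Proof. intros H ->. exact (Z_degenerate H). Qed.

Ltac new_neq a b pf :=
  lazymatch goal with
  | _ : a <> b |- _ => fail
  | _ => assert (a <> b) by exact pf
  end.

Ltac zneq := repeat match goal with
  | H : Z ?a ?b ?c |- _ =>
     first [new_neq a b (Z_neq12 H)|new_neq b c (Z_neq23 H)|new_neq a c (Z_neq13 H)]
  end.

(* Two orders of the same three points exclude each other. *)
Ltac zno :=
  let Q := fresh in intros Q;
  match goal with
  | H : Z ?a ?b ?c |- _ =>
     first [exact (Z_asym H Q)|exact (Z_asym (Z_sym H) Q)
           |exact (Z_asym H (Z_sym Q))|exact (Z_asym (Z_sym H) (Z_sym Q))]
  end.

Lemma lam_of_L a b c : L a b c -> a <> b -> b <> c -> c <> a -> lam a b c.
Proof. unfold Defs.L. tauto. Qed.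

Lemma L_cases a b c : L a b c -> a <> b -> b <> c -> a <> c ->
  Z a b c \/ Z b c a \/ Z c a b.
Proof. unfold Defs.L, Defs.lam. intuition congruence. Qed.

Lemma line_point_unique x y b b' : x <> y -> L x y b -> L x y b' ->
  len x b = len x b' -> len y b = len y b' -> b = b'.
Proof.
intros xy Hb Hb' E1 E2.
destruct (classic (x = b)) as [<-|xb].
{ apply (@len_eq _ _ x). cg. }
destruct (classic (y = b)) as [<-|yb].
{ apply (@len_eq _ _ y). cg. }
assert (x <> b'). { intros <-. apply xb. apply (@len_eq _ _ x). cg. }
assert (y <> b'). { intros <-. apply yb. apply (@len_eq _ _ y). cg. }
apply (@transport_unique x y b x y); auto; apply lam_of_L; auto.
Qed.

Lemma equidistant_line A B x y : A <> B -> x <> y ->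
  len A x = len A y -> len B x = len B y ->
  ~ L A B x /\ exists z, L A B z /\ Z x z y.
Proof.
intros AB xy E1 E2.
assert (N : ~ L A B x).
{ intros H. destruct (classic (L A B y)) as [K|K].
  - exact (xy (line_point_unique AB H K E1 E2)).
  - destruct (@refl_crosses A B y x) as [z [K1 K2]]; auto.
    apply K. zneq. assert (L x z y) by col. 
    apply (@L_line x z); auto; col. }
split; [exact N|]. apply refl_crosses; auto.
Qed.

Lemma equidistant_extend A B x y z : A <> B ->
  len A x = len A y -> len B x = len B y -> L A B z -> len z x = len z y.
Proof.
intros AB E1 E2 Hz. destruct (classic (x = y)) as [->|xy]; [reflexivity|].
destruct (equidistant_line AB xy E1 E2) as [N _].
apply (@five_segments A B z x A B z y); auto.
Qed.

(** If x and y differed, each side line of the triangle would cross xy between x and y in a point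
    equidistant from both. There is only one such point, so the three side lines would be
    concurrent. *)
Lemma equidistant_3 A B C x y : ~ L A B C ->
  len A x = len A y -> len B x = len B y -> len C x = len C y -> x = y.
Proof.
intros N EA EB EC. apply NNPP. intros xy.
assert (AB : A <> B) by (intros ->; apply N; apply L_aab).
assert (AC : A <> C) by (intros ->; apply N; apply L_aba).
assert (BC : B <> C) by (intros ->; apply N; apply L_baa).
destruct (equidistant_line AB xy EA EB) as [N1 [u [Lu Zu]]].
destruct (equidistant_line AC xy EA EC) as [N2 [v [Lv Zv]]].
destruct (equidistant_line BC xy EB EC) as [N3 [w [Lw Zw]]].
assert (U : forall u v, Z x u y -> Z x v y -> len u x = len u y -> len v x = len v y -> u = v).
{ intros u' v' K1 K2 F1 F2. apply NNPP. intros uv.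
  apply xy. apply (@line_point_unique u' v'); auto; col. }
assert (u = v).
{ apply U; auto; [apply (@equidistant_extend A B)|apply (@equidistant_extend A C)]; auto. }
assert (u = w).
{ apply U; auto; [apply (@equidistant_extend A B)|apply (@equidistant_extend B C)]; auto. }
subst v w.
destruct (classic (u = A)) as [->|uA]; [apply N; col|].
apply N. apply (@L_line A u); auto; col.
Qed.

(** * Reflections in lines *)

(** Choice makes the reflection a total function. For a = b every point counts as collinear and is
    fixed, hence the hypothesis a <> b in most of the lemmas. *)
Definition refl a b x : P :=
  epsilon (inhabits x) (fun x' => (L a b x /\ x' = x) \/
    (~ L a b x /\ x' <> x /\ len a x = len a x' /\ len b x = len b x')).

Lemma refl_spec a b x : (L a b x /\ refl a b x = x) \/
    (~ L a b x /\ refl a b x <> x /\ len a x = len a (refl a b x) /\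
     len b x = len b (refl a b x)).
Proof.
unfold refl. apply epsilon_spec.
destruct (classic (L a b x)) as [H|H]; [exists x; tauto|].
destruct (refl_ex H) as [x' K]. exists x'; tauto.
Qed.

Lemma refl_on a b x : L a b x -> refl a b x = x.
Proof. intros H. destruct (refl_spec a b x); tauto. Qed.

Lemma refl_off a b x : ~ L a b x -> refl a b x <> x.
Proof. intros H. destruct (refl_spec a b x); tauto. Qed.

Lemma refl_dist a b x y : a <> b -> L a b y -> len y (refl a b x) = len y x.
Proof.
intros ab H. destruct (refl_spec a b x) as [[_ ->]|[_ [_ [E1 E2]]]]; [reflexivity|].
symmetry. apply (@equidistant_extend a b); auto.
Qed.

Lemma refl_eq a b x y : a <> b -> x <> y -> len a x = len a y -> len b x = len b y ->
  refl a b x = y.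
Proof.
intros ab xy E1 E2. destruct (equidistant_line ab xy E1 E2) as [N _].
destruct (refl_spec a b x) as [?|[_ [H1 [H2 H3]]]]; [tauto|].
apply (@refl_unique a b x); auto.
Qed.

Lemma refl_foot a b x : a <> b -> ~ L a b x ->
  exists y, L a b y /\ Z x y (refl a b x).
Proof.
intros ab N. destruct (refl_spec a b x) as [?|[_ [H1 [H2 H3]]]]; [tauto|].
apply refl_crosses; auto.
Qed.

Lemma refl_invol a b x : a <> b -> refl a b (refl a b x) = x.
Proof.
intros ab. destruct (classic (L a b x)) as [H|H].
{ rewrite !(refl_on H). reflexivity. }
apply refl_eq; auto using refl_off; rewrite refl_dist; auto; col.
Qed.

Lemma refl_off_line a b x : a <> b -> ~ L a b x -> ~ L a b (refl a b x).
Proof.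
intros ab H K. apply (refl_off H). rewrite <- (refl_invol x ab) at 2.
symmetry. apply refl_on. exact K.
Qed.

Lemma refl_line a b c d x : a <> b -> c <> d -> L a b c -> L a b d ->
  refl c d x = refl a b x.
Proof.
intros ab cd Hc Hd. destruct (classic (L a b x)) as [H|H].
{ rewrite !refl_on; auto. col. }
apply refl_eq; auto.
- intros K. symmetry in K. revert K. apply refl_off; auto.
- rewrite refl_dist; auto.
- rewrite refl_dist; auto.
Qed.

Definition isometry (f : P -> P) := forall x y, len (f x) (f y) = len x y.

(** The point c common to the axis and xy is fixed, so (A8) carries c, x, y to c, x', y'. By the
    five-segment axiom y' has the distances of y to the whole axis, and therefore is its mirror
    image. *)
Lemma refl_isometry_meet a b x y c : a <> b -> ~ L a b x -> ~ L a b y -> x <> y ->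
  L a b c -> L c x y -> len (refl a b x) (refl a b y) = len x y.
Proof.
intros ab Nx Ny xy Hc Hl.
assert (cx : c <> x) by congruence. assert (cy : c <> y) by congruence.
set (x' := refl a b x). 
assert (E : forall z, L a b z -> len z x' = len z x) by (intros; apply refl_dist; auto).
destruct (@transport c x y c x') as [y' [K1 [K2 K3]]].
{ apply lam_of_L; auto. } { rewrite E; auto. }
assert (Nc : forall z, L a b z -> z <> c -> ~ L c x z).
{ intros z Hz zc K. apply Nx. apply (@L_line c z); auto; col. }
assert (E' : forall z, L a b z -> len z y = len z y').
{ intros z Hz. destruct (classic (z = c)) as [->|zc]; [exact K2|].
  rewrite (len_sym z y), (len_sym z y').
  apply (@five_segments c x y z c x' y' z); auto; try (rewrite E; auto).
  - left; exact K1.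
  - rewrite len_sym, (len_sym x'), E; auto. }
assert (N : y <> y').
{ intros <-.
  assert (xx' : x <> x') by (intros Q; apply (refl_off Nx); auto).
  assert (L c x' y) by (left; exact K1).
  apply xx'. apply (@line_point_unique c y); auto; try col.
  - rewrite E; auto.
  - cg. }
assert (Ry : refl a b y = y').
{ apply refl_eq; auto; apply E'; auto; col. }
rewrite Ry. cg.
Qed.

Lemma refl_isometry a b : a <> b -> isometry (refl a b).
Proof.
intros ab x y.
destruct (classic (L a b x)) as [Hx|Nx].
{ rewrite (refl_on Hx). apply refl_dist; auto. }
destruct (classic (L a b y)) as [Hy|Ny].
{ rewrite (refl_on Hy), len_sym, (len_sym x). apply refl_dist; auto. }
destruct (classic (x = y)) as [->|xy]; [apply len_refl|].
destruct (refl_foot ab Ny) as [q [Lq Zq]].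
destruct (classic (L q x y)) as [K|K].
{ exact (refl_isometry_meet ab Nx Ny xy Lq K). }
assert (qx : q <> x) by congruence. assert (qy : q <> y) by congruence.
set (y' := refl a b y) in *.
assert (Ny' : ~ L a b y') by (apply refl_off_line; auto).
assert (He : exists e, L a b e /\ e <> q).
{ destruct (classic (a = q)) as [->|]; [exists b|exists a]; split; auto; col. }
destruct He as [e [Le eq]].
(* The axis enters the triangle y y' x through the foot q of y, so by Pasch it leaves through xy or
   xy'. One of these two lines thus meets the axis. *)
assert (M : (exists c, L a b c /\ L c x y) \/ (exists c, L a b c /\ L c x y')).
{ zneq. destruct (@pasch _ _ _ HP y y' x q e) as [f [F1 F2]]; auto.
  - intros Q. apply K. apply (@L_line y y'); auto; col.
  - intros Q. apply Ny. assert (L q e y) by col2. col2.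
  - intros ->. tauto.
  - intros Q. apply Nx. assert (L x q e) by (left; exact Q). apply (@L_line q e); auto; col.
  - assert (Lf : L a b f).
    { destruct F2 as [F2| ->]; auto. assert (L e q f) by (left; exact F2).
      apply (@L_line e q); auto; col. }
    destruct F1; [left|right]; exists f; split; auto; col. }
destruct M as [[c [Lc Hc]]|[c [Lc Hc]]].
{ exact (refl_isometry_meet ab Nx Ny xy Lc Hc). }
destruct (classic (x = y')) as [->|xy'].
{ unfold y'. rewrite refl_invol; auto. apply len_sym. }
assert (E := refl_isometry_meet ab Nx Ny' xy' Lc Hc).
unfold y' in E at 1. rewrite refl_invol in E; auto.
assert (yy' : y' <> y) by (apply refl_off; auto).
assert (Eq : forall z, len q (refl a b z) = len q z) by (intros; apply refl_dist; auto).
set (x' := refl a b x) in *.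
assert (Ex : len q x' = len q x) by apply Eq.
assert (Ey : len q y' = len q y) by apply Eq.
rewrite (len_sym x' y'), (len_sym x y).
(* From x'y = xy' the wanted x'y' = xy follows by turning the triple y', q, y round about its
   midpoint q, with x going to x'. *)
symmetry. apply (@five_segments y' q y x y q y' x'); try col; try cg.
intros Q. apply K. apply (@L_line y' q); try col. congruence.
Qed.

(* The angle xoy is right. *)
Definition Rt x o y := o <> x /\ o <> y /\
  exists y', Z y o y' /\ len o y = len o y' /\ len x y = len x y'.

Lemma Rt_noncol x o y : Rt x o y -> ~ L o x y.
Proof.
intros [ox [oy [y' [H [E1 E2]]]]] K. zneq.
apply (Z_neq13 H). apply (@line_point_unique o x); auto. col.
Qed.

(** Let x' be the mirror image of x in oy. Both x and x' are equidistant from y and y', hence so is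
    the point z where xx' meets oy; thus z = o, and x' is the point required. *)
Lemma Rt_sym x o y : Rt x o y -> Rt y o x.
Proof.
intros R. assert (N := Rt_noncol R). destruct R as [ox [oy [y' [H [E1 E2]]]]]. zneq.
assert (N' : ~ L o y x) by (intros K; apply N; col).
split; [auto|split; [auto|]].
destruct (refl_foot oy N') as [z [Lz Zz]].
set (x' := refl o y x) in *.
assert (D : forall u, L o y u -> len u x' = len u x) by (intros; apply refl_dist; auto).
assert (Dy : len y x' = len y x) by (apply D; col).
assert (Dy' : len y' x' = len y' x) by (apply D; col).
assert (Do : len o x' = len o x) by (apply D; col).
assert (Ez : len z y = len z y').
{ apply (@equidistant_extend x x'); auto; try col; try cg. exact (Z_neq13 Zz). }
assert (z = o).
{ apply NNPP. intros zo. apply (Z_neq13 H). apply (@line_point_unique z o); auto; col. }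
subst z. exists x'. split; [exact Zz|]. split; cg.
Qed.

Lemma Rt_extend x o y z : Rt x o y -> L o x z -> z <> o -> Rt z o y.
Proof.
intros [ox [oy [y' [H [E1 E2]]]]] K zo. split; [auto|split; [auto|]].
exists y'. repeat split; auto. apply (@equidistant_extend o x); auto.
Qed.

(** No triangle has two right angles: both would produce the same mirror image p1 of p in fx, and f
    and x would both lie on pp1. *)
Lemma Rt_two x f p : Rt x f p -> Rt f x p -> False.
Proof.
intros R1 R2. assert (N := Rt_noncol R1).
destruct R1 as [fx [fp [p1 [H1 [E1 E2]]]]], R2 as [_ [xp [p2 [H2 [F1 F2]]]]].
zneq.
assert (Q1 : refl f x p = p1) by (apply refl_eq; auto).
assert (Q2 : refl f x p = p2) by (apply refl_eq; auto).
assert (p1 = p2) by congruence. clear Q1 Q2. subst p2.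
apply N. apply (@L_line p p1); auto; col.
Qed.

Lemma foot_ex a b p : a <> b -> ~ L a b p ->
  exists f, L a b f /\ f <> p /\ forall x, L a b x -> x <> f -> Rt x f p.
Proof.
intros ab N. destruct (refl_foot ab N) as [f [Lf Zf]].
exists f. assert (f <> p) by congruence. repeat split; auto.
exists (refl a b p). rewrite !refl_dist; auto.
Qed.

Lemma altitude a o b : Rt a o b -> exists c, Z a c b /\ Rt o c a /\ Rt o c b.
Proof.
intros R. assert (N := Rt_noncol R).
assert (ab : a <> b) by (intros ->; apply N; col).
assert (oa : o <> a) by (intros ->; apply N; col).
assert (ob : o <> b) by (intros ->; apply N; col).
assert (N' : ~ L a b o) by (intros K; apply N; col).
destruct (foot_ex ab N') as [c [Lc [co Rc]]].
assert (ca : c <> a).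
{ intros ->. apply (@Rt_two o a b).
  - apply Rt_sym, Rc; auto; col.
  - exact R. }
assert (cb : c <> b).
{ intros ->. apply (@Rt_two o b a).
  - apply Rt_sym, Rc; auto; col.
  - apply Rt_sym. exact R. }
exists c. assert (Ra : Rt o c a) by (apply Rt_sym, Rc; auto; col).
assert (Rb : Rt o c b) by (apply Rt_sym, Rc; auto; col).
repeat split; try (apply Ra); try (apply Rb).
destruct R as [_ [_ [b' [H1 [H2 H3]]]]].
destruct Ra as [_ [_ [a' [K1 [K2 K3]]]]].
rewrite lenP in H2, H3, K2, K3. apply Z_sym.
apply (altitude_foot_between HP (a:=b) (o:=o) (a':=b') (b:=a) (c:=c) (b':=a')); auto.
apply lam_of_L; auto. col.
Qed.

(** Altitude feet supply points between: ab is made the hypotenuse of a right triangle whose third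
    vertex is the foot of b on ax or of a on bx. Both feet cannot degenerate to a and b, by
    [Rt_two]. *)
Lemma density a b : a <> b -> exists c, Z a c b.
Proof.
intros ab. destruct (off_line ab) as [x Hx].
assert (ax : a <> x) by (intros ->; apply Hx; col).
assert (bx : b <> x) by (intros ->; apply Hx; col).
assert (Nb : ~ L a x b) by (intros K; apply Hx; col).
assert (Na : ~ L b x a) by (intros K; apply Hx; col).
destruct (foot_ex ax Nb) as [z [Lz [zb Rz]]].
destruct (classic (z = a)) as [->|za].
- destruct (foot_ex bx Na) as [w [Lw [wa Rw]]].
  destruct (classic (w = b)) as [->|wb].
  + exfalso. apply (@Rt_two b a x).
    * apply Rt_sym, Rz; auto; col.
    * apply Rt_sym, Rw; auto; col.
  + destruct (@altitude a w b) as [c [Hc _]]; [|exists c; auto].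
    apply Rt_sym, Rw; auto; col.
- destruct (@altitude a z b) as [c [Hc _]]; [|exists c; auto].
  apply Rz; auto; col.
Qed.

(** * Sides of a line and order on a line *)

(* Strictly on opposite sides, respectively on the same side, of the line ab. *)
Definition OS a b x y := ~ L a b x /\ ~ L a b y /\ exists z, L a b z /\ Z x z y.
Definition SS a b x y := ~ L a b x /\ ~ L a b y /\ ~ OS a b x y.

Lemma OS_sym a b x y : OS a b x y -> OS a b y x.
Proof.
intros [H1 [H2 [z [H3 H4]]]]. repeat split; auto. exists z. auto using Z_sym.
Qed.

Lemma SS_sym a b x y : SS a b x y -> SS a b y x.
Proof. intros [H1 [H2 H3]]. repeat split; auto. intros K; apply H3, OS_sym, K. Qed.

Lemma OS_neq a b x y : OS a b x y -> a <> b.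
Proof. intros [H1 _] ->. apply H1. apply L_aab. Qed.

Lemma SS_neq a b x y : SS a b x y -> a <> b.
Proof. intros [H1 _] ->. apply H1. apply L_aab. Qed.

Lemma SS_or_OS a b x y : ~ L a b x -> ~ L a b y -> SS a b x y \/ OS a b x y.
Proof. intros. destruct (classic (OS a b x y)); [right|left]; auto. split; auto. Qed.

Lemma OS_irrefl a b x : ~ OS a b x x.
Proof. intros [_ [_ [z [_ H]]]]. exact (Z_neq13 H eq_refl). Qed.

Lemma SS_refl a b x : ~ L a b x -> SS a b x x.
Proof. intros. repeat split; auto. apply OS_irrefl. Qed.

Lemma other_point a b q : a <> b -> L a b q -> exists e, L a b e /\ e <> q.
Proof.
intros ab H. destruct (classic (a = q)) as [->|]; [exists b|exists a]; split; auto; col.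
Qed.

Lemma OS_split_noncol a b x y w : ~ L x y w -> ~ L a b w -> OS a b x y ->
  OS a b x w \/ OS a b y w.
Proof.
intros N Nw H. assert (ab := OS_neq H). destruct H as [Nx [Ny [z [Lz Zz]]]].
destruct (other_point ab Lz) as [e [Le ez]]. zneq.
assert (wz : w <> z) by congruence.
assert (we : w <> e) by congruence.
destruct (@pasch _ _ _ HP x y w z e) as [f [F1 F2]]; auto.
- intros K. apply Nx. assert (L z e x) by (apply (@L_line x y); auto; col).
  apply (@L_line z e); auto; col.
- intros K. apply Nw. assert (L w z e) by (left; exact K).
  apply (@L_line z e); auto; col.
- assert (Lf : L a b f).
  { destruct F2 as [F2| ->]; auto. assert (L e z f) by (left; exact F2).
    apply (@L_line e z); auto; col. }
  destruct F1; [left|right]; repeat split; auto; exists f; auto.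
Qed.

(** Pasch for the triangle y f h and the line xw, which separates f from h at g: it would have to
    meet yf or yh, but it meets the lines xy and yw only in x and w, outside these segments. *)
Lemma OS_excl_between a b x y w f g h : ~ L x y w ->
  ~ L a b x -> ~ L a b y -> ~ L a b w -> a <> b -> L a b f -> L a b g -> L a b h ->
  Z x f y -> Z x g w -> Z y h w -> ~ Z f g h.
Proof.
intros N Nx Ny Nw ab Lf Lg Lh Zf Zg Zh K. zneq.
assert (Nyfh : ~ L f h y).
{ intros Q. apply Ny. col2. }
assert (Lxg : L x g w) by col.
assert (O : OS x w f h).
{ repeat split.
  - intros Q. apply N. assert (L x f w) by col. apply (@L_line x f); auto; col.
  - intros Q. apply N. assert (L h w x) by col. apply (@L_line h w); auto; col.
  - exists g. split; auto. col. }
assert (Ny' : ~ L x w y) by (intros Q; apply N; col).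
destruct (@OS_split_noncol x w f h y Nyfh Ny' O) as [[_ [_ [u [Lu Zu]]]]|[_ [_ [u [Lu Zu]]]]].
- assert (u = x).
  { apply NNPP. intros ux. apply N. zneq. assert (L x y u) by col.
    apply (@L_line x u); auto; col. }
  subst u. apply Z_sym in Zu. exact (Z_asym (Z_sym Zf) Zu).
- assert (u = w).
  { apply NNPP. intros uw. apply N. zneq. assert (L y w u) by col.
    apply (@L_line w u); auto; col. }
  subst u. apply Z_sym in Zu. exact (Z_asym Zh Zu).
Qed.

Lemma OS_excl_noncol a b x y w : ~ L x y w ->
  OS a b x y -> OS a b x w -> OS a b y w -> False.
Proof.
intros N H1 H2 H3. assert (ab := OS_neq H1).
destruct H1 as [Nx [Ny [f [Lf Zf]]]], H2 as [_ [Nw [g [Lg Zg]]]], H3 as [_ [_ [h [Lh Zh]]]].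
assert (N1 : ~ L y x w) by (intros K; apply N; col).
assert (N2 : ~ L w x y) by (intros K; apply N; col).
assert (N3 : ~ L x w y) by (intros K; apply N; col).
zneq.
assert (fg : f <> g).
{ intros <-. apply N. apply (@L_line x f); auto; col. }
assert (fh : f <> h).
{ intros <-. apply N. apply (@L_line y f); auto; col. }
assert (gh : g <> h).
{ intros <-. apply N. apply (@L_line w g); auto; col. }
destruct (@L_cases f g h) as [K|[K|K]]; auto.
- apply (@L_line a b); auto.
- revert K. apply (@OS_excl_between a b x y w f g h); auto.
- apply Z_sym in K. revert K.
  apply (@OS_excl_between a b y x w f h g); auto using Z_sym.
- revert K. apply (@OS_excl_between a b y w x h f g); auto using Z_sym.
  intros Q; apply N; col.
Qed.

Lemma off_two_lines a b x y : a <> b -> ~ L a b x -> x <> y ->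
  exists g, ~ L a b g /\ ~ L x y g.
Proof.
intros ab N xy.
destruct (classic (L x y a)) as [Ha|Ha].
- assert (Hb : ~ L x y b).
  { intros K. apply N. apply (@L_line x y); auto; col. }
  destruct (@density x b) as [g Zg].
  { intros ->. apply Hb. col. }
  exists g. zneq. split; intros K.
  + apply N. assert (L b g x) by col. apply (@L_line b g); auto; col.
  + apply Hb. apply (@L_line x g); auto; col.
- destruct (@density x a) as [g Zg].
  { intros ->. apply Ha. col. }
  exists g. zneq. split; intros K.
  + apply N. apply (@L_line a g); auto; col.
  + apply Ha. apply (@L_line x g); auto; col.
Qed.

(** Pasch says nothing about three collinear points. A point g off both lines reduces this case to
    noncollinear triples. *)
Lemma OS_split a b x y w : ~ L a b w -> OS a b x y -> OS a b x w \/ OS a b y w.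
Proof.
intros Nw H. destruct (classic (L x y w)) as [K|K]; [|apply OS_split_noncol; auto].
assert (ab := OS_neq H). pose proof H as [Nx [Ny [z [Lz Zz]]]]. zneq.
destruct (@off_two_lines a b x y) as [g [Ng1 Ng2]]; auto.
destruct (classic (w = x)) as [->|wx]; [right; apply OS_sym; auto|].
destruct (classic (w = y)) as [->|wy]; [left; auto|].
assert (N1 : ~ L x g w).
{ intros Q. apply Ng2. apply (@L_line x w); auto; col. }
assert (N2 : ~ L y g w).
{ intros Q. apply Ng2. apply (@L_line y w); auto; col. }
assert (N1' : ~ L g w y) by (intros Q; apply N2; col).
assert (N2' : ~ L g w x) by (intros Q; apply N1; col).
destruct (@OS_split_noncol a b x y g) as [G|G]; auto.
- destruct (@OS_split_noncol a b x g w) as [G'|G']; auto.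
  destruct (@OS_split_noncol a b g w y) as [G2|G2]; auto.
  + exfalso. apply (@OS_excl_noncol a b x y g); auto using OS_sym.
  + right. apply OS_sym; auto.
- destruct (@OS_split_noncol a b y g w) as [G'|G']; auto.
  destruct (@OS_split_noncol a b g w x) as [G2|G2]; auto.
  + exfalso. apply (@OS_excl_noncol a b x y g); auto using OS_sym.
  + left. apply OS_sym; auto.
Qed.

Lemma OS_excl a b x y w : OS a b x y -> OS a b x w -> OS a b y w -> False.
Proof.
intros H1 H2 H3.
destruct (classic (L x y w)) as [K|K]; [|apply (@OS_excl_noncol a b x y w); auto].
assert (ab := OS_neq H1). pose proof H1 as [Nx [Ny [z [Lz Zz]]]]. zneq.
pose proof H2 as [_ [Nw [z' [_ Zz']]]]. pose proof H3 as [_ [_ [z'' [_ Zz'']]]]. zneq.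
destruct (@off_two_lines a b x y) as [g [Ng1 Ng2]]; auto.
assert (N1 : ~ L x w g).
{ intros Q. apply Ng2. apply (@L_line x w); auto; col. }
assert (N2 : ~ L y w g).
{ intros Q. apply Ng2. apply (@L_line y w); auto; col. }
destruct (@OS_split a b x y g) as [G|G]; auto.
- destruct (@OS_split a b y w g) as [G'|G']; auto.
  + apply (@OS_excl_noncol a b x y g); auto.
  + apply (@OS_excl_noncol a b x w g); auto.
- destruct (@OS_split a b x w g) as [G'|G']; auto.
  + apply (@OS_excl_noncol a b x y g); auto.
  + apply (@OS_excl_noncol a b y w g); auto.
Qed.

Lemma SS_trans a b x y w : SS a b x y -> SS a b y w -> SS a b x w.
Proof.
intros [H1 [H2 H3]] [_ [K2 K3]]. repeat split; auto. intros Q.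
destruct (OS_split H2 Q) as [Q'|Q']; [auto|apply K3, OS_sym; auto].
Qed.

Lemma OS_SS a b x y w : OS a b x y -> SS a b y w -> OS a b x w.
Proof.
intros H [_ [K2 K3]]. destruct (OS_split K2 H) as [Q|Q]; auto. contradiction.
Qed.

Lemma OS_OS a b x y w : OS a b x y -> OS a b y w -> SS a b x w.
Proof.
intros H K. repeat split; [apply H|apply K|]. intros Q.
exact (OS_excl H Q K).
Qed.

Lemma OS_not_SS a b x y : OS a b x y -> SS a b x y -> False.
Proof. intros H [_ [_ K]]. auto. Qed.

Lemma SS_line a b c d x y : c <> d -> L a b c -> L a b d -> SS a b x y -> SS c d x y.
Proof.
intros cd Lc Ld H. assert (ab := SS_neq H). destruct H as [H1 [H2 H3]].
assert (E : forall u, L c d u -> L a b u).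
{ intros u K. apply (@L_line c d); auto; apply (@L_line a b); auto; col. }
repeat split; auto. intros [_ [_ [z [Lz Zz]]]]. apply H3. repeat split; auto.
exists z; auto.
Qed.

Lemma OS_of_Z a b x z y : a <> b -> ~ L a b x -> L a b z -> Z x z y -> OS a b x y.
Proof.
intros ab N Lz Zz. repeat split; auto; [|exists z; auto].
intros K. apply N. zneq. assert (L z y a) by (apply (@L_line a b); auto; col).
assert (L z y b) by (apply (@L_line a b); auto; col). apply (@L_line z y); auto; col.
Qed.

Lemma Z_of_OS a b x z y : OS a b x y -> L a b z -> L x y z -> Z x z y.
Proof.
intros H Lz K. assert (ab := OS_neq H). destruct H as [Nx [Ny [w [Lw Zw]]]].
assert (z = w); [|congruence]. apply NNPP; intros zw. apply Nx. zneq.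
assert (L x y w) by col.
assert (L z w x) by (apply (@L_line x y); auto; col).
apply (@L_line z w); auto; apply (@L_line a b); auto; col.
Qed.

Lemma SS_ray a b o x y : a <> b -> L a b o -> ~ L a b x -> L o x y -> o <> y ->
  ~ Z x o y -> SS a b x y.
Proof.
intros ab Lo N K oy H.
assert (ox : o <> x) by congruence.
assert (Ny : ~ L a b y).
{ intros Q. apply N. assert (L o y a) by (apply (@L_line a b); auto; col).
  assert (L o y b) by (apply (@L_line a b); auto; col). apply (@L_line o y); auto; col. }
destruct (SS_or_OS N Ny) as [?|Q]; auto.
exfalso. apply H. apply (Z_of_OS Q); auto. col.
Qed.

(** A line oe across the given one turns order around o into a statement on sides. *)
Lemma between_opposite o x y w : L o x w -> o <> w -> Z x o y -> ~ Z x o w -> Z w o y.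
Proof.
intros K ow H N. zneq. assert (Hxo : x <> o) by auto.
destruct (off_line Hxo) as [e He].
assert (oe : o <> e) by (intros ->; apply He; col).
assert (Nx : ~ L o e x) by (intros Q; apply He; col).
assert (S : SS o e x w) by (apply (@SS_ray o e o); auto; col).
assert (O : OS o e x y) by (apply (@OS_of_Z o e x o); auto; col).
apply (@Z_of_OS o e).
- apply OS_sym, (@OS_SS o e y x w); auto using OS_sym.
- col.
- apply (@L_line x o); auto; col.
Qed.

Lemma between_opposite_excl o x y w : Z x o y -> Z x o w -> ~ Z y o w.
Proof.
intros H K Q. zneq. assert (H10 : x <> o) by auto.
destruct (off_line H10) as [e He].
assert (oe : o <> e) by (intros ->; apply He; col).
assert (Nx : ~ L o e x) by (intros G; apply He; col).
assert (Ny : ~ L o e y).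
{ intros G. apply He. apply (@L_line o y); auto; col. }
apply (@OS_excl o e x y w); apply (@OS_of_Z o e _ o); auto; col.
Qed.

Lemma Z_trans1 a b c d : Z a b c -> Z a c d -> Z b c d /\ Z a b d.
Proof.
intros H K. zneq. assert (Q : Z b c d).
{ apply (@between_opposite c a d b); auto; try col. apply Z_asym. exact H. }
zneq. split; auto. apply Z_sym. apply (@between_opposite b c a d); auto; try col.
- apply Z_sym; auto.
- zno.
Qed.

Lemma Z_trans2 a b c d : Z a b c -> Z b c d -> Z a b d /\ Z a c d.
Proof.
intros H K. zneq.
assert (ad : a <> d). { intros <-. exact (Z_asym H (Z_sym K)). }
split.
- apply Z_sym. apply (@between_opposite b c a d); auto; try col.
  + apply Z_sym; auto.
  + zno.
- apply (@between_opposite c b d a); auto; try col.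
  zno.
Qed.

(* The order of the line oi in which o precedes i. *)
Definition lt o i x y :=
  (Z x o i /\ ~ Z y o i) \/ (Z x o i /\ Z y o i /\ Z x y o) \/
  (~ Z x o i /\ ~ Z y o i /\ x <> y /\ (x = o \/ Z o x y)).

Lemma lt_irrefl o i x : ~ lt o i x x.
Proof. intros [H|[H|H]]; try tauto. exact (Z_neq12 (proj2 (proj2 H)) eq_refl). Qed.

Lemma lt_across o i x y : L o i x -> L o i y -> Z x o i -> ~ Z y o i -> y <> o -> Z x o y.
Proof.
intros Lx Ly H K yo. apply Z_sym. apply (@between_opposite o i x y); auto using Z_sym.
Qed.

Lemma lt_total o i x y : o <> i -> L o i x -> L o i y -> x <> y -> lt o i x y \/ lt o i y x.
Proof.
intros oi Lx Ly xy.
destruct (classic (Z x o i)) as [Nx|Nx], (classic (Z y o i)) as [Ny|Ny].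
- assert (H : ~ Z x o y) by (apply (@between_opposite_excl o i); auto using Z_sym).
  zneq. destruct (@L_cases x y o) as [Q|[Q|Q]]; auto; try col2.
  + left; right; left; auto.
  + destruct (H (Z_sym Q)).
  + right; right; left; repeat split; auto; apply Z_sym; auto.
- left; left; auto.
- right; left; auto.
- destruct (classic (x = o)) as [->|xo].
  { left. right. right. auto. }
  destruct (classic (y = o)) as [->|yo].
  { right. right. right. auto. }
  assert (H : ~ Z x o y).
  { intros Q. apply Ny. apply Z_sym. apply (@between_opposite o x y i); auto. col2. }
  destruct (@L_cases x y o) as [Q|[Q|Q]]; auto; try col2.
  + right; right; right; repeat split; auto. right; apply Z_sym; auto.
  + destruct (H (Z_sym Q)).
  + left; right; right; auto.
Qed.

Lemma lt_chain o i x y z : L o i x -> L o i y -> L o i z ->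
  lt o i x y -> lt o i y z -> Z x y z.
Proof.
intros Lx Ly Lz H K.
destruct H as [[H1 H2]|[[H1 [H2 H3]]|[H1 [H2 [H3 H4]]]]],
  K as [[K1 K2]|[[K1 [K2 K3]]|[K1 [K2 [K3 K4]]]]]; try tauto.
- destruct K4 as [->|K4].
  + apply (@lt_across o i); auto.
  + assert (yo : y <> o) by (intros ->; exact (Z_neq12 K4 eq_refl)).
    apply (Z_trans2 (lt_across Lx Ly H1 H2 yo) K4).
- destruct (classic (z = o)) as [->|zo]; auto.
  apply (Z_trans2 H3 (lt_across Ly Lz H2 K2 zo)).
- apply Z_sym. apply (Z_trans1 (Z_sym K3) (Z_sym H3)).
- destruct K4 as [->|K4].
  + destruct H4 as [->|H4]; [congruence|]. destruct (Z_neq13 H4 eq_refl).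
  + destruct H4 as [->|H4]; [auto|]. apply (Z_trans1 H4 K4).
Qed.

Lemma lt_trans o i x y z : o <> i -> L o i x -> L o i y -> L o i z ->
  lt o i x y -> lt o i y z -> lt o i x z.
Proof.
intros oi Lx Ly Lz H K. assert (Q := lt_chain Lx Ly Lz H K).
destruct (lt_total oi Lx Lz (Z_neq13 Q)) as [?|G]; [assumption|].
exfalso. assert (Q' := lt_chain Ly Lz Lx K G). exact (Z_asym Q (Z_sym Q')).
Qed.

Lemma filter_length_le (f g : P -> bool) (l : list P) :
  (forall x, In x l -> f x = true -> g x = true) ->
  length (filter f l) <= length (filter g l).
Proof.
induction l as [|y l IH]; intros H; simpl; [lia|].
assert (IH' : length (filter f l) <= length (filter g l)).
{ apply IH. intros x Hx. apply H. right; auto. }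
specialize (H y (or_introl eq_refl)).
destruct (f y), (g y); simpl; lia.
Qed.

Lemma filter_length_lt (f g : P -> bool) (l : list P) y :
  (forall x, In x l -> f x = true -> g x = true) ->
  In y l -> f y = false -> g y = true ->
  length (filter f l) < length (filter g l).
Proof.
induction l as [|z l IH]; intros H Hy E1 E2; simpl; [contradiction|].
assert (IH' : length (filter f l) <= length (filter g l)).
{ apply filter_length_le. intros x Hx. apply H. right; auto. }
destruct Hy as [->|Hy].
- rewrite E1, E2. simpl. lia.
- specialize (IH (fun x Hx => H x (or_intror Hx)) Hy E1 E2).
  specialize (H z (or_introl eq_refl)).
  destruct (f z), (g z); simpl; lia.
Qed.

Lemma lt_Z a b x y z : a <> b -> L a b x -> L a b y -> L a b z ->
  Z x y z -> (lt a b x y /\ lt a b y z) \/ (lt a b z y /\ lt a b y x).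
Proof.
intros ab Lx Ly Lz H. zneq.
assert (C := @lt_chain a b).
destruct (@lt_total a b x y) as [G1|G1], (@lt_total a b y z) as [G2|G2]; auto; exfalso.
- destruct (@lt_total a b x z) as [G3|G3]; auto.
  + exact (Z_asym H (C x z y Lx Lz Ly G3 G2)).
  + exact (Z_asym (Z_sym H) (C z x y Lz Lx Ly G3 G1)).
- destruct (@lt_total a b x z) as [G3|G3]; auto.
  + exact (Z_asym (Z_sym H) (Z_sym (C y x z Ly Lx Lz G1 G3))).
  + exact (Z_asym H (Z_sym (C y z x Ly Lz Lx G2 G3))).
Qed.

(* Finitely many points of a line can be numbered along the line, which leaves
   order arguments on a line to [lia]. *)
Lemma rank_ex a b (l : list P) : a <> b -> (forall x, In x l -> L a b x) ->
  exists r : P -> nat,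
    (forall x y z, In x l -> In y l -> In z l ->
       (Z x y z <-> (r x < r y < r z \/ r z < r y < r x))) /\
    (forall x y, In x l -> In y l -> (x = y <-> r x = r y)) /\
    (forall x y, In x l -> In y l -> (lt a b x y <-> r x < r y)).
Proof.
intros ab Hl.
set (r := fun x => length (filter
  (fun y => if excluded_middle_informative (lt a b y x) then true else false) l)).
assert (R : forall x y, In x l -> In y l -> lt a b x y -> r x < r y).
{ intros x y Hx Hy H. apply (@filter_length_lt _ _ _ x); auto.
  - intros u Hu.
    destruct (excluded_middle_informative (lt a b u x)),
      (excluded_middle_informative (lt a b u y)); auto.
    exfalso. apply n. apply (@lt_trans a b u x y); auto.
  - destruct (excluded_middle_informative (lt a b x x)) as [K|K]; auto.
    destruct (lt_irrefl K).
  - destruct (excluded_middle_informative (lt a b x y)) as [K|K]; [reflexivity|contradiction]. }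
assert (R' : forall x y, In x l -> In y l -> r x < r y -> lt a b x y).
{ intros x y Hx Hy H. destruct (classic (x = y)) as [->|xy]; [lia|].
  destruct (@lt_total a b x y) as [K|K]; auto. apply R in K; auto; lia. }
assert (I : forall x y, In x l -> In y l -> r x = r y -> x = y).
{ intros x y Hx Hy H. apply NNPP. intros xy.
  destruct (@lt_total a b x y) as [K|K]; auto; apply R in K; auto; lia. }
exists r. repeat split; auto; [|intros [G|G]|congruence].
- intros G. destruct (@lt_Z a b x y z) as [[K1 K2]|[K1 K2]]; auto.
- apply (@lt_chain a b); auto; apply R'; tauto.
- apply Z_sym, (@lt_chain a b); auto; apply R'; tauto.
Qed.

Ltac ord_in := simpl; repeat first [left; reflexivity|right].
Ltac ord_on := let x := fresh in let H := fresh in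
  intros x H; simpl in H;
  repeat (destruct H as [H|H]; [subst x; solve [col2]|]); destruct H.

(* Decides statements on the order of the listed points of the line ab. *)
Ltac ord a b l :=
  let r := fresh "r" in let HZ := fresh in let HI := fresh in let HL := fresh in
  let ab := fresh in
  assert (ab : a <> b) by auto;
  destruct (@rank_ex a b l ab ltac:(ord_on)) as [r [HZ [HI HL]]];
  clear ab;
  repeat match goal with
  | |- context [Z ?x ?y ?z] => rewrite (HZ x y z) by ord_in
  | |- context [lt a b ?x ?y] => rewrite (HL x y) by ord_in
  | |- context [?x = ?y :> P] => rewrite (HI x y) by ord_in
  | H : context [?x = ?y :> P] |- _ => rewrite (HI x y) in H by ord_in
  | H : context [Z ?x ?y ?z] |- _ => rewrite (HZ x y z) in H by ord_in
  | H : context [lt a b ?x ?y] |- _ => rewrite (HL x y) in H by ord_in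
  end;
  clear HZ HI HL; lia.

(** * Isometries and bisectors *)

(** The correspondence exchanging a with c and b with d is extended to the line ab. The five-segment
    axiom is applied to c (going to a) and to d (going to b). *)
Lemma swap_transport a b c d t : len a b = len c d -> len a d = len c b ->
  ~ L a b c -> ~ L a b d -> lam a b t ->
  exists t', L c d t' /\ len a t = len c t' /\ len b t = len d t' /\
    len c t = len a t' /\ len d t = len b t'.
Proof.
intros E1 E2 N1 N2 H.
destruct (transport H E1) as [t' [K1 [K2 K3]]].
exists t'. assert (K : L c d t') by (left; exact K1).
assert (H' : L a b t) by (left; exact H).
split; auto. split; [cg|]. split; [cg|]. split.
- assert (len t c = len t' a); [|cg].
  apply (@five_segments a b t c c d t' a); auto; cg.
- assert (len t d = len t' b); [|cg].
  apply (@five_segments a b t d c d t' b); auto; cg.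
Qed.

(* The congruence exchanging a with c and b with d exchanges the lines ab and cd,
   so it fixes their intersection. *)
Lemma swap_fix a b c d t : len a b = len c d -> len a d = len c b ->
  ~ L a b c -> ~ L a b d -> ~ L c d a -> ~ L c d b -> L a b t -> L c d t ->
  len t a = len t c /\ len t b = len t d.
Proof.
intros E1 E2 N1 N2 N3 N4 H1 H2.
assert (ab : a <> b) by (intros ->; apply N1; col).
assert (cd : c <> d) by (intros ->; apply N3; col).
assert (ta : t <> a) by congruence. assert (tb : t <> b) by congruence.
assert (tc : t <> c) by congruence. assert (td : t <> d) by congruence.
destruct (@swap_transport a b c d t) as [t1 [A1 [A2 [A3 [A4 A5]]]]]; auto.
{ apply lam_of_L; auto. }
destruct (@swap_transport c d a b t) as [t2 [B1 [B2 [B3 [B4 B5]]]]]; auto.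
{ apply lam_of_L; auto. }
(* The image of t as a point of ab and its image as a point of cd have the same distances to a, b,
   c. The common image lies on both lines, so it is t. *)
assert (t1 = t2) by (apply (@equidistant_3 a b c); auto; cg). subst t2.
assert (t1 = t).
{ apply NNPP. intros Q. apply N1.
  assert (L t t1 a) by col2. assert (L t t1 b) by col2. assert (L t t1 c) by col2. col2. }
subst t1. split; cg.
Qed.

Lemma swap_transport2 a b c d t : len a b = len c d -> len a d = len c b ->
  ~ L a c b -> ~ L a c d -> lam a c t ->
  exists t', L a c t' /\ len a t = len c t' /\ len b t = len d t' /\
    len c t = len a t' /\ len d t = len b t'.
Proof.
intros E1 E2 N1 N2 H.
destruct (@transport a c t c a H) as [t' [K1 [K2 K3]]]; [cg|].
exists t'. assert (K : L c a t') by (left; exact K1).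
assert (H' : L a c t) by (left; exact H).
split; [col|]. split; [cg|].
assert (len t b = len t' d).
{ apply (@five_segments a c t b c a t' d); auto; cg. }
assert (len t d = len t' b).
{ apply (@five_segments a c t d c a t' b); auto; cg. }
split; [cg|]. split; cg.
Qed.

(* The congruence exchanging a with c and b with d preserves the lines ac and bd. *)
Lemma swap_fix2 a b c d t : len a b = len c d -> len a d = len c b ->
  ~ L a c b -> ~ L a c d -> ~ L b d a -> ~ L b d c -> L a c t -> L b d t ->
  len t a = len t c /\ len t b = len t d.
Proof.
intros E1 E2 N1 N2 N3 N4 H1 H2.
assert (ac : a <> c) by (intros ->; apply N1; col).
assert (bd : b <> d) by (intros ->; apply N3; col).
assert (ta : t <> a) by congruence. assert (tb : t <> b) by congruence.
assert (tc : t <> c) by congruence. assert (td : t <> d) by congruence.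
destruct (@swap_transport2 a b c d t) as [t1 [A1 [A2 [A3 [A4 A5]]]]]; auto.
{ apply lam_of_L; auto. }
destruct (@swap_transport2 b a d c t) as [t2 [B1 [B2 [B3 [B4 B5]]]]]; auto; try cg.
{ apply lam_of_L; auto. }
assert (t1 = t2) by (apply (@equidistant_3 a c b); auto; cg). subst t2.
assert (t1 = t).
{ apply NNPP. intros Q. apply N1.
  assert (L t t1 a) by col2. assert (L t t1 b) by col2. assert (L t t1 c) by col2. col2. }
subst t1. split; cg.
Qed.

(** If zx = zw, a copy of x and w on a second line through z gives four points equidistant from z.
    Two joins of these points meet in a t with tx = tw, so zt crosses xw between x and w; the
    crossing can only be z, against [Z z x w]. *)
Lemma ray_unique_aux z x w : Z z x w -> len z x <> len z w.
Proof.
intros H E. zneq.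
assert (G : exists g, ~ L z x g /\ Rt z g x).
{ assert (zx : z <> x) by auto. destruct (off_line zx) as [u Hu].
  assert (zu : z <> u) by (intros ->; apply Hu; col).
  assert (Nx : ~ L z u x) by (intros Q; apply Hu; col).
  destruct (foot_ex zu Nx) as [f [Lf [fx Rf]]].
  destruct (classic (f = z)) as [->|fz].
  - assert (R : Rt u z x) by (apply Rf; auto; col).
    destruct (altitude R) as [g [Zg [_ Rg]]]. exists g. split; auto.
    zneq. intros Q. apply Hu. col2.
  - exists f. split; [|apply Rf; auto; col].
    intros Q. apply Hu. col2. }
destruct G as [g [Ng [gz [gx [y [Zy [E1 E2]]]]]]].
assert (Ny : ~ L z x y). { intros Q. apply Ng. zneq. col2. }
assert (zy : z <> y) by (intros ->; apply Ny; col).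
destruct (@transport z x w z y) as [y2 [K1 [K2 K3]]]; [left; exact H|exact E2|].
assert (Ly2 : L z y y2) by (left; exact K1).
assert (zy2 : z <> y2). { intros <-. apply (Z_neq13 H). symmetry. apply (@len_eq w z z). cg. }
assert (yy2 : y <> y2).
{ intros <-. apply (Z_neq23 H). apply (@len_eq x w y). cg. }
assert (F1 : len w y = len y2 x).
{ apply (@five_segments z x w y z y y2 x); auto; try col; cg. }
assert (Nwy : ~ L z w y) by (intros Q; apply Ny; col2).
assert (F2 : len x y = len y2 w).
{ apply (@five_segments z w x y z y y2 w); auto; try col; cg. }
(* The order of y and [y2] on their line is unknown. It decides which pair of joins is known to
   cross: xy with w[y2], or x[y2] with wy. *)
assert (T : exists t, ~ L z x t /\ len t x = len t w).
{ assert (N1 : ~ L x y w) by (intros Q; apply Ny; col2).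
  assert (N2 : ~ L x y y2) by (intros Q; apply Ny; col2).
  assert (N3 : ~ L w y2 x) by (intros Q; apply Ny; assert (L z w y2) by col2; col2).
  assert (N4 : ~ L w y2 y) by (intros Q; apply Ny; assert (L z y w) by col2; col2).
  assert (N5 : ~ L x y2 w) by (intros Q; apply Ny; assert (L z w y2) by col2; col2).
  assert (N6 : ~ L x y2 y) by (intros Q; apply Ny; assert (L z y x) by col2; col2).
  assert (N7 : ~ L w y x) by (intros Q; apply Ny; col2).
  assert (N8 : ~ L w y y2) by (intros Q; apply Ny; assert (L z y w) by col2; col2).
  destruct (classic (Z z y2 y)) as [Q|Q].
  - assert (xy : x <> y) by (intros ->; apply Ny; col).
    assert (O : OS x y z w) by (apply (@OS_of_Z x y z x w); auto; try col; intros G; apply Ny; col).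
    destruct (OS_split N2 O) as [O'|O'].
    + exfalso. assert (Z z y y2) by (apply (@Z_of_OS x y); auto; col).
      apply (Z_asym Q). auto.
    + destruct O' as [_ [_ [t [Lt Zt]]]]. exists t. zneq. split.
      * intros G. apply Ny. assert (L z x y2) by col2. col2.
      * apply (@swap_fix x y w y2 t); auto; try cg; col.
  - assert (xy2 : x <> y2) by (intros ->; apply Ny; col).
    assert (O : OS x y2 z w).
    { apply (@OS_of_Z x y2 z x w); auto; try col. intros G; apply N6; col2. }
    destruct (OS_split N6 O) as [O'|O'].
    + exfalso. apply Q. apply (@Z_of_OS x y2); auto; col.
    + destruct O' as [_ [_ [t [Lt Zt]]]]. exists t. zneq. split.
      * intros G. apply Ny. col2.
      * apply (@swap_fix x y2 w y t); auto; try cg; col. }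
destruct T as [t [Nt Et]].
assert (zt : z <> t) by (intros <-; apply Nt; col).
destruct (@equidistant_line z t x w) as [_ [u [Lu Zu]]]; auto.
assert (u = z).
{ apply NNPP. intros uz. apply Nt. zneq. assert (L z x u) by col2. col2. }
subst u. exact (Z_asym (Z_sym H) (Z_sym Zu)).
Qed.

Lemma ray_unique o x y : L o x y -> ~ Z x o y -> len o x = len o y -> x = y.
Proof.
intros K N E.
destruct (classic (o = x)) as [<-|ox].
{ symmetry. apply (@len_eq _ _ o). cg. }
destruct (classic (o = y)) as [<-|oy].
{ apply (@len_eq _ _ o). cg. }
apply NNPP. intros xy.
destruct (@L_cases o x y) as [Q|[Q|Q]]; auto.
- exact (ray_unique_aux Q E).
- apply (ray_unique_aux (Z_sym Q)). auto.
- exact (N (Z_sym Q)).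
Qed.

Lemma Rt_unique x o y w : Rt x o y -> Rt x o w -> L o y w.
Proof.
intros R1 R2.
apply Rt_sym in R1. apply Rt_sym in R2.
destruct R1 as [oy [ox [x1 [H1 [E1 E2]]]]], R2 as [ow [_ [x2 [K1 [F1 F2]]]]].
zneq.
assert (x1 = x2).
{ apply (@ray_unique o); [col2| |congruence]. exact (between_opposite_excl H1 K1). }
subst x2. apply NNPP. intros N. apply (Z_neq13 H1).
apply (@equidistant_3 o y w); auto.
Qed.

(** With y on va and its copy y' on vb, the congruence exchanging the two legs fixes the
    intersection t of yb and y'a, or of yy' and ab; then vt is the axis. *)
Lemma bisector_noncol v a b : ~ L v a b -> len v a = len v b ->
  exists t, v <> t /\ refl v t a = b /\ len t a = len t b.
Proof.
intros N E.
assert (va : v <> a) by (intros ->; apply N; col).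
assert (vb : v <> b) by (intros ->; apply N; col).
assert (ab : a <> b) by (intros ->; apply N; col).
destruct (density va) as [y Zy]. zneq.
destruct (@transport v a y v b) as [y' [K1 [K2 K3]]]; auto.
{ apply lam_of_L; auto. col. }
assert (Ly' : L v b y') by (left; exact K1).
assert (vy' : v <> y').
{ intros <-. apply (Z_neq12 Zy). symmetry. apply (@len_eq y v v). cg. }
assert (by' : b <> y').
{ intros <-. apply (Z_neq23 Zy). symmetry. apply (@len_eq a y b). cg. }
assert (F1 : len y b = len y' a).
{ apply (@five_segments v a y b v b y' a); auto; try col; cg. }
assert (T : exists t, v <> t /\ len t a = len t b).
{ assert (Lvy : L v y a) by col.
  assert (yb : y <> b) by (intros ->; apply N; col).
  assert (N0 : ~ L v y b) by (intros Q; apply N; col2).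
  assert (N1 : ~ L y b v) by (intros Q; apply N0; col).
  assert (N2 : ~ L y b y') by (intros Q; apply N0; col2).
  assert (N3 : ~ L y b a) by (intros Q; apply N; col2).
  assert (N4 : ~ L y' a y) by (intros Q; apply N; assert (L v a y') by col2; col2).
  assert (N5 : ~ L y' a b) by (intros Q; apply N; assert (L v b a) by col2; col2).
  (* (A8) does not tell that y' is between v and b. If b lies between v and y', the lines yy' and ab
     are the ones that meet. *)
  assert (O : OS y b v a) by (apply (@OS_of_Z y b v y a); auto; col).
  destruct (OS_split N2 O) as [O'|O'].
  - assert (Zb : Z v b y') by (apply (@Z_of_OS y b); auto; col).
    zneq.
    assert (yy' : y <> y') by (intros <-; apply N2; col).
    assert (M1 : ~ L y y' v) by (intros Q; apply N2; col2).
    assert (M2 : ~ L y y' b) by (intros Q; apply N2; col).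
    assert (M3 : ~ L y y' a) by (intros Q; apply N4; col).
    assert (O2 : OS y y' v a) by (apply (@OS_of_Z y y' v y a); auto; col).
    destruct (OS_split M2 O2) as [O3|O3].
    + exfalso. assert (Q : Z v y' b) by (apply (@Z_of_OS y y'); auto; col).
      exact (Z_asym Zb Q).
    + destruct O3 as [_ [_ [t [Lt Zt]]]]. exists t. split.
      * intros ->. apply N. col.
      * apply (@swap_fix2 y a y' b t); auto; try cg; try col; intros Q.
        -- apply N3; col.
        -- apply N5; col.
  - destruct O' as [_ [_ [t [Lt Zt]]]]. exists t. split.
    + intros ->. apply N. zneq. col2.
    + symmetry. apply (@swap_fix y b y' a t); auto; try cg; col. }
destruct T as [t [vt Et]]. exists t. repeat split; auto.
apply refl_eq; auto.
Qed.

Lemma refl_Rt a b x f y : a <> b -> ~ L a b x -> L a b f -> L f x (refl a b x) ->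
  L a b y -> y <> f -> Rt y f x.
Proof.
intros ab N Lf Lx Ly yf.
destruct (refl_foot ab N) as [g [Lg Zg]].
assert (f = g).
{ apply NNPP. intros fg. apply N. zneq. assert (L f g x) by col2. col2. }
subst g. assert (f <> x) by congruence. repeat split; auto.
exists (refl a b x). rewrite !refl_dist; auto.
Qed.

(** Distinct feet f, g and a common point z off ab would form a triangle with two right angles; with
    a common foot, [Rt_unique] applies. *)
Lemma perpendiculars_eq a b x y z : a <> b -> ~ L a b x -> ~ L a b y ->
  L x (refl a b x) z -> L y (refl a b y) z -> L x (refl a b x) y.
Proof.
intros ab Nx Ny Hx Hy.
destruct (refl_foot ab Nx) as [f [Lf Zf]]. destruct (refl_foot ab Ny) as [g [Lg Zg]].
zneq.
assert (Rf : forall e, L a b e -> e <> f -> Rt e f x).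
{ intros e Le ef. apply (@refl_Rt a b); auto. col. }
assert (Rg : forall e, L a b e -> e <> g -> Rt e g y).
{ intros e Le eg. apply (@refl_Rt a b); auto. col. }
assert (f = g).
{ apply NNPP. intros fg. destruct (classic (L a b z)) as [Lz|Nz].
  - assert (z = f). { apply NNPP. intros Q. apply Nx. assert (L z f x) by col2. col2. }
    subst z. apply Ny. assert (L f g y) by col2. col2.
  - apply (@Rt_two g f z).
    + assert (R := Rf g Lg (not_eq_sym fg)).
      apply Rt_sym, (@Rt_extend x); [apply Rt_sym; auto|col2|congruence].
    + assert (R := Rg f Lf fg).
      apply Rt_sym, (@Rt_extend y); [apply Rt_sym; auto|col2|congruence]. }
subst g.
destruct (other_point ab Lf) as [e [Le ef]].
assert (L f x y) by (apply (@Rt_unique e); auto).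
col2.
Qed.

(** (A8) yields a point w' of the image line with the distances that f w should have. By
    [equidistant_line], a second point with these distances would force w' off that line. *)
Lemma isometry_L f u v w : isometry f -> L u v w -> L (f u) (f v) (f w).
Proof.
intros If H.
destruct (classic (u = v)) as [->|uv]; [apply L_aab|].
destruct (classic (u = w)) as [->|uw]; [apply L_aba|].
destruct (classic (v = w)) as [->|vw]; [apply L_baa|].
apply NNPP. intros N.
destruct (@transport u v w (f u) (f v)) as [w' [K1 [K2 K3]]].
{ apply lam_of_L; auto. } { symmetry; apply If. }
assert (K : L (f u) (f v) w') by (left; exact K1).
assert (fuv : f u <> f v) by (intros Q; apply N; rewrite Q; apply L_aab).
destruct (@equidistant_line (f u) (f v) w' (f w)) as [Q _]; auto.
- intros Q. subst w'. auto.
- rewrite If. auto.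
- rewrite If. auto.
Qed.

Definition motion f := isometry f /\ (forall u v w, Z u v w -> Z (f u) (f v) (f w)) /\
  exists g, isometry g /\ (forall x, g (f x) = x) /\ (forall x, f (g x) = x).

(** The perpendicular to the axis through v is mapped to itself. It cannot separate u from its
    image, because u and its image are joined by another perpendicular. *)
Lemma refl_SS_perp a b v u (r := refl a b) : a <> b -> ~ L a b v -> ~ L v (r v) u -> SS v (r v) u (r u).
Proof.
intros ab Nv Nu.
assert (vv : v <> r v) by (intros Q; apply (refl_off Nv); auto).
assert (Nu' : ~ L v (r v) (r u)).
{ intros Q. apply Nu. apply (isometry_L (refl_isometry ab)) in Q. fold r in Q.
  unfold r in Q. rewrite !refl_invol in Q; auto. fold (r v) in Q. col. }
destruct (classic (L a b u)) as [Lu|Lu].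
{ unfold r at 2. rewrite refl_on; auto. apply SS_refl; auto. }
destruct (SS_or_OS Nu Nu') as [?|[_ [_ [z [Lz Zz]]]]]; auto.
exfalso. apply Nu. apply (@perpendiculars_eq a b v u z); auto. fold (r u). zneq. col.
Qed.

Lemma refl_Z_good a b u v w (r := refl a b) : a <> b -> ~ L a b v -> ~ L v (r v) u -> ~ L v (r v) w ->
  Z u v w -> Z (r u) (r v) (r w).
Proof.
intros ab Nv Nu Nw H.
assert (vv : v <> r v) by (intros Q; apply (refl_off Nv); auto).
assert (Su := refl_SS_perp ab Nv Nu). assert (Sw := refl_SS_perp ab Nv Nw).
assert (O : OS v (r v) u w) by (apply (@OS_of_Z v (r v) u v w); auto; col).
apply (@Z_of_OS v (r v)).
- apply (@OS_SS _ _ _ w); auto. apply OS_sym, (@OS_SS _ _ _ u); auto using OS_sym.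
- col.
- assert (L (r u) (r v) (r w)); [|col]. apply isometry_L; [apply refl_isometry; auto|col].
Qed.

Lemma refl_Z_axis a b u v w (r := refl a b) : a <> b -> L a b v -> Z u v w -> Z (r u) (r v) (r w).
Proof.
intros ab Lv H. zneq. unfold r. rewrite (refl_on Lv).
destruct (classic (L a b u)) as [Lu|Nu].
{ rewrite !refl_on; auto. col2. }
assert (O : OS a b u w) by (apply (@OS_of_Z a b u v w); auto).
assert (Nw : ~ L a b w) by apply O.
assert (M : forall t, ~ L a b t -> OS a b t (refl a b t)).
{ intros t Nt. destruct (refl_foot ab Nt) as [z [Lz Zz]].
  apply (@OS_of_Z a b t z); auto. }
apply (@Z_of_OS a b); auto.
- apply (@OS_SS a b _ u); [apply OS_sym; auto|].
  apply (@OS_OS a b u w); auto.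
- assert (Q : L (refl a b u) (refl a b v) (refl a b w)).
  { apply isometry_L; [apply refl_isometry; auto|col]. }
  rewrite (refl_on Lv) in Q. col.
Qed.

(** The case left over is that u, v, w lie on one perpendicular to the axis. There the order is
    recovered from auxiliary points whose order relations are in positions already treated. *)
Lemma refl_Z a b u v w (r := refl a b) : a <> b -> Z u v w -> Z (r u) (r v) (r w).
Proof.
intros ab H. zneq.
destruct (classic (L a b v)) as [Lv|Nv]; [apply refl_Z_axis; auto|].
assert (vv : v <> r v) by (intros Q; apply (refl_off Nv); auto).
destruct (classic (L v (r v) u)) as [Lu|Nu].
2:{ destruct (classic (L v (r v) w)) as [Lw|Nw]; [|apply refl_Z_good; auto].
    exfalso. apply Nu. col2. }
assert (Lw : L v (r v) w) by col2.
destruct (refl_foot ab Nv) as [f [Lf Zf]]. fold (r v) in Zf.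
destruct (other_point ab Lf) as [e [Le ef]]. zneq.
assert (Ne : ~ L v (r v) e).
{ intros Q. apply Nv. assert (L e f v) by col2. col2. }
assert (Neu : ~ L e u v). { intros Q. apply Ne. col2. }
assert (eu : e <> u) by (intros ->; apply Neu; col).
assert (ev : e <> v) by (intros ->; apply Neu; col).
assert (ew : e <> w) by (intros ->; apply Ne; auto).
(* With e on the axis and k between e and u, let j be the point where ev meets kw. The reflected
   relations [Z e k u] and [Z w j k] put the images of u and w on opposite sides of the image of
   ev. *)
destruct (density eu) as [k Zk]. zneq.
assert (Nk : ~ L v (r v) k) by (intros Q; apply Ne; assert (L k u e) by col; col2).
assert (Nwk : ~ L e v w) by (intros Q; apply Neu; col2).
assert (O1 : OS e v u w).
{ apply (@OS_of_Z e v u v w); auto; try col. intros Q; apply Neu; col. }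
assert (S1 : SS e v u k).
{ apply (@SS_ray e v e u k); auto; try col.
  - intros Q; apply Neu; col.
  - zno. }
assert (O2 : OS e v k w) by (apply OS_sym, (@OS_SS e v w u k); auto using OS_sym).
destruct O2 as [N2 [_ [j [Lj Zj]]]]. zneq.
assert (Zej : Z e j v).
{ assert (M1 : ~ L w k e) by (intros Q; apply Ne; assert (L k e u) by col;
    assert (L k e w) by col; col2).
  assert (M2 : ~ L w k u).
  { intros Q. apply Nk. col2. }
  assert (wk : w <> k) by auto.
  assert (O3 : OS w k e u) by (apply (@OS_of_Z w k e k u); auto; col).
  assert (S3 : SS w k u v).
  { apply (@SS_ray w k w u v); auto; try col.
    zno. }
  apply (@Z_of_OS w k).
  - apply (@OS_SS w k e u v); auto.
  - col.
  - col. }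
assert (Nj : ~ L v (r v) j) by (intros Q; apply Ne; zneq; assert (L j v e) by col; col2).
assert (P1 : forall x, ~ L a b x -> ~ L v (r v) x -> forall y, L v (r v) y -> ~ L x (r x) y).
{ intros x Nx Nvx y Ly Q. apply Nvx. apply (@perpendiculars_eq a b v x y); auto. }
assert (jnab : ~ L a b j).
{ intros Q. apply Nv. zneq. assert (L e j v) by col. col2. }
assert (jj : j <> r j) by (intros Q; apply (refl_off jnab); auto).
assert (Z1 : Z (r e) (r j) (r v)).
{ apply refl_Z_good; auto.
  - intros Q. apply (P1 j jnab Nj v); [col|]. zneq. col2.
  - apply P1; auto; col. }
assert (Z3 : Z (r w) (r j) (r k)).
{ apply refl_Z_good; auto using Z_sym.
  intros Q. apply (P1 j jnab Nj w); [col|]. col2. }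
assert (Z2 : Z (r e) (r k) (r u)).
{ destruct (classic (L a b u)) as [Lu'|Nu'].
  - unfold r. rewrite !refl_on; auto. col2.
  - assert (knab : ~ L a b k) by (intros Q; apply Nu'; col2).
    assert (kk : k <> r k) by (intros Q; apply (refl_off knab); auto).
    apply refl_Z_good; auto.
    intros Q. apply (P1 k knab Nk u); [col|]. col2. }
assert (I := refl_isometry ab). fold r in I.
assert (Inj : forall x y, r x = r y -> x = y).
{ intros x y Q. apply (@len_eq x y x). rewrite <- (I x y), Q. apply len_refl. }
assert (LI : forall x y z, L (r x) (r y) (r z) -> L x y z).
{ intros x y z Q. apply (isometry_L I) in Q. unfold r in Q.
  rewrite !refl_invol in Q; auto. }
assert (Lr : L (r u) (r v) (r w)) by (apply isometry_L; auto; col).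
apply (@Z_of_OS (r e) (r v)); [|col|col].
assert (rev : r e <> r v) by auto.
assert (Nu' : ~ L (r e) (r v) (r u)) by (intros Q; apply LI in Q; apply Neu; col).
assert (Nw' : ~ L (r e) (r v) (r w)) by (intros Q; apply LI in Q; apply Nwk; col).
assert (Lj' : L (r e) (r v) (r j)) by (apply isometry_L; auto; col).
assert (O4 : OS (r e) (r v) (r w) (r k)) by (apply (@OS_of_Z _ _ _ (r j)); auto).
assert (S4 : SS (r e) (r v) (r u) (r k)).
{ apply (@SS_ray _ _ (r e)); auto; try col; zneq; auto.
  zno. }
apply OS_sym, (@OS_SS _ _ _ (r k)); auto using SS_sym.
Qed.

Lemma motion_refl a b : a <> b -> motion (refl a b).
Proof.
intros ab. split; [apply refl_isometry; auto|]. split; [intros; apply refl_Z; auto|].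
exists (refl a b). split; [apply refl_isometry; auto|].
split; intros; apply refl_invol; auto.
Qed.

(** * Motions and point reflections *)

Lemma isometry_inj f x y : isometry f -> f x = f y -> x = y.
Proof. intros I Q. apply (@len_eq x y x). rewrite <- (I x y), Q. apply len_refl. Qed.

Lemma isometry_comp f g : isometry f -> isometry g -> isometry (fun x => f (g x)).
Proof. intros If Ig x y. rewrite If. apply Ig. Qed.

Lemma motion_isometry f : motion f -> isometry f.
Proof. intros [H _]. exact H. Qed.

Lemma motion_comp f g : motion f -> motion g -> motion (fun x => f (g x)).
Proof.
intros [F1 [F2 [f' [F3 [F4 F5]]]]] [G1 [G2 [g' [G3 [G4 G5]]]]].
split; [apply isometry_comp; auto|]. split; [auto|].
exists (fun x => g' (f' x)). split; [apply isometry_comp; auto|].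
split; intros x; [rewrite F4, G4|rewrite G5, F5]; reflexivity.
Qed.

Lemma motion_L f u v w : motion f -> (L (f u) (f v) (f w) <-> L u v w).
Proof.
intros [F1 [F2 [g [F3 [F4 F5]]]]]. split; [|apply isometry_L; auto].
intros H. apply (isometry_L F3) in H. rewrite !F4 in H. exact H.
Qed.

Lemma isometry_rigid f g a b c : isometry f -> isometry g -> ~ L (f a) (f b) (f c) ->
  f a = g a -> f b = g b -> f c = g c -> forall x, f x = g x.
Proof.
intros If Ig N Ea Eb Ec x.
apply (@equidistant_3 (f a) (f b) (f c)); auto.
- rewrite Ea at 2. rewrite If, Ig. reflexivity.
- rewrite Eb at 2. rewrite If, Ig. reflexivity.
- rewrite Ec at 2. rewrite If, Ig. reflexivity.
Qed.

(** The right angle at e makes e the midpoint of b and some [b2]. Moving be onto eb sends [b2] to a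
    point e' with b as midpoint of ee', and any x of the line can then be transported from eb to
    e'b. *)
Lemma extend_foot p e b x : Rt p e b -> L e b x -> x <> b ->
  exists x', Z x b x' /\ len b x = len b x'.
Proof.
intros [_ [eb [b2 [H [E _]]]]] Lx xb. zneq.
destruct (@transport b e b2 e b) as [e' [K1 [K2 K3]]]; [left; exact H|cg|].
assert (Le : L e b e') by (left; exact K1).
assert (ee : e <> e').
{ intros <-. apply (Z_neq13 H). apply (@len_eq b b2 e). cg. }
assert (Ze : Z e b e').
{ apply NNPP. intros Q. apply ee. apply (@ray_unique b); auto; [col|cg]. }
zneq.
destruct (classic (x = e)) as [->|xe].
{ exists e'. split; auto. cg. }
destruct (@transport e b x e' b) as [x' [A1 [A2 A3]]]; [apply lam_of_L; auto|cg|].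
assert (Lx' : L e' b x') by (left; exact A1).
exists x'. split; auto.
apply NNPP. intros Q.
assert (x = x') by (apply (@ray_unique b); auto; col2). subst x'.
apply (Z_neq13 Ze). apply (@line_point_unique b x); auto; try col; try cg.
Qed.

Lemma extend_off a b x : ~ L a b x -> (exists f, L a b f /\ f <> b /\ Rt x f b) ->
  exists x', Z x b x' /\ len b x = len b x'.
Proof.
intros N [f [Lf [fb R]]].
assert (N' : ~ L f x b) by (intros Q; apply (Rt_noncol R); auto).
destruct (altitude R) as [e [Ze [Re Rb]]].
apply (@extend_foot f e b x); auto. col. intros ->. apply N; col.
Qed.

(** Let y <> b be the foot of some x, and r the reflection in yb. The rays from b to x and x' = r x
    and their prolongations form a cross symmetric about yb; the mirror k of the adjacent arms to x'
    and to the prolongation of x is the perpendicular. *)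
Lemma Rt_erect a b : a <> b -> exists w, Rt a b w.
Proof.
intros ab. destruct (off_line ab) as [x Nx].
destruct (foot_ex ab Nx) as [y [Ly [yx Ry]]].
destruct (classic (y = b)) as [->|yb].
{ exists x. apply Ry; auto. col. }
assert (R : Rt x y b) by (apply Rt_sym, Ry; auto; col).
assert (bx : b <> x) by (intros ->; apply Nx; col).
set (r := refl y b). assert (yb' : y <> b) by auto.
assert (Mr : motion r) by (apply motion_refl; auto).
assert (Ny : ~ L y b x) by (intros Q; apply (Rt_noncol R); col).
destruct (@extend_off a b x Nx) as [xo [Zxo Exo]]; [exists y; auto|].
set (x' := r x).
assert (rb : r b = b) by (apply refl_on; col).
assert (ry : r y = y) by (apply refl_on; col).
assert (Zxo' : Z x' b (r xo)).
{ rewrite <- rb. apply Mr. exact Zxo. }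
assert (Ex : len b x' = len b x) by (apply refl_dist; auto; col).
assert (Exo' : len b (r xo) = len b xo) by (apply refl_dist; auto; col).
assert (Nx' : ~ L y b x') by (apply refl_off_line; auto).
assert (xx' : x' <> x) by (apply refl_off; auto).
zneq.
assert (Nb : ~ L b x x').
{ destruct (refl_foot yb' Ny) as [f [Lf Zf]]. fold r x' in Zf. intros Q.
  assert (f = b).
  { apply NNPP. intros fb. apply Ny. zneq. assert (L f b x) by col2. col2. }
  subst f. apply (@Rt_two y b x); [|exact (Rt_sym R)].
  apply (@refl_Rt y b x b y); auto; try col. }
assert (N1 : ~ L b x' xo) by (intros Q; apply Nb; col2).
destruct (@bisector_noncol b x' xo N1) as [t [bt [Kt _]]]; [cg|].
set (k := refl b t) in *.
assert (Mk : motion k) by (apply motion_refl; auto).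
assert (kb : k b = b) by (apply refl_on; col).
assert (kxo : k xo = x').
{ rewrite <- Kt. apply refl_invol; auto. }
assert (kx : k x = r xo).
{ assert (Q : Z x' b (k x)).
  { rewrite <- kxo, <- kb. apply Mk. apply Z_sym; auto. }
  apply (@ray_unique b).
  - zneq. col2.
  - exact (between_opposite_excl Q Zxo').
  - rewrite <- kb at 1. rewrite (motion_isometry Mk). cg. }
(* y, b and k y are all equidistant from [xo] and [r xo]. Were they not collinear, these two points
   would coincide. *)
assert (Lky : L y b (k y)).
{ apply NNPP. intros N.
  assert (Q : xo = r xo).
  { apply (@equidistant_3 y b (k y)); auto.
    - rewrite <- ry at 2. rewrite (motion_isometry Mr). reflexivity.
    - rewrite <- kx, <- Kt. rewrite !(motion_isometry Mk).
      unfold x'. rewrite <- ry at 1. rewrite (motion_isometry Mr). reflexivity. }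
  assert (x = r x).
  { apply (@ray_unique b).
    - fold x'. zneq. rewrite <- Q in Zxo'. col2.
    - fold x'. rewrite <- Q in Zxo'. exact (between_opposite_excl (Z_sym Zxo) (Z_sym Zxo')).
    - fold x'. cg. }
  apply xx'. auto. }
assert (kyy : k y <> y).
{ intros Q.
  assert (Lb : L b t y).
  { apply NNPP. intros N. apply (refl_off N). exact Q. }
  assert (x = xo).
  { rewrite <- Kt. unfold k, x', r. rewrite (@refl_line b t y b); auto; try col.
    rewrite refl_invol; auto. }
  congruence. }
assert (Eky : len b (k y) = len b y).
{ rewrite <- kb at 1. apply (motion_isometry Mk). }
assert (Zy : Z y b (k y)).
{ apply NNPP. intros Q. apply kyy. symmetry. apply (@ray_unique b); auto. col. }
exists t. apply (@Rt_extend y).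
- apply Rt_sym. repeat split; auto. exists (k y). repeat split; auto.
  unfold k. rewrite refl_dist; auto. col.
- col2.
- auto.
Qed.

Lemma extend a b : a <> b -> exists c, Z a b c /\ len b a = len b c.
Proof.
intros ab. destruct (Rt_erect ab) as [w R].
apply Rt_sym in R. destruct R as [_ [_ [c [H [E _]]]]]. exists c. auto.
Qed.

Lemma bisector v a b : v <> a -> a <> b -> len v a = len v b ->
  exists t, v <> t /\ refl v t a = b.
Proof.
intros va ab E.
destruct (classic (L v a b)) as [K|K].
- assert (H : Z a v b) by (apply NNPP; intros Q; apply ab, (@ray_unique v); auto).
  destruct (@Rt_erect a v) as [w R]; auto. exists w.
  pose proof (Rt_sym R) as [vw [_ [c [Hc [E1 E2]]]]]. split; auto.
  assert (b = c).
  { apply (@ray_unique v); [zneq; col2|exact (between_opposite_excl H Hc)|cg]. }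
  subst c. apply refl_eq; auto.
- destruct (bisector_noncol K E) as [t [vt [Q _]]]. exists t. auto.
Qed.

(* Point reflection in o. *)
Definition pr o x : P := epsilon (inhabits x) (fun x' =>
  (x = o /\ x' = o) \/ (x <> o /\ Z x o x' /\ len o x = len o x')).

Lemma pr_spec o x : (x = o /\ pr o x = o) \/
  (x <> o /\ Z x o (pr o x) /\ len o x = len o (pr o x)).
Proof.
unfold pr. apply epsilon_spec.
destruct (classic (x = o)) as [H|H]; [exists o; auto|].
destruct (extend H) as [x' K]. exists x'. auto.
Qed.

Lemma pr_o o : pr o o = o.
Proof. destruct (pr_spec o o) as [H|H]; tauto. Qed.

Lemma pr_Z o x : x <> o -> Z x o (pr o x).
Proof. intros. destruct (pr_spec o x) as [K|K]; tauto. Qed.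

Lemma pr_len o x : len o (pr o x) = len o x.
Proof. destruct (pr_spec o x) as [[-> ->]|K]; [reflexivity|symmetry; apply K]. Qed.

Lemma pr_eq o x y : Z x o y -> len o x = len o y -> pr o x = y.
Proof.
intros H E. zneq. assert (K := @pr_Z o x). assert (E' := pr_len o x).
apply (@ray_unique o); [assert (Q := K H0); zneq; col2|exact (between_opposite_excl (K H0) H)|cg].
Qed.

Lemma pr_invol o x : pr o (pr o x) = x.
Proof.
destruct (classic (x = o)) as [->|H]; [rewrite !pr_o; reflexivity|].
apply pr_eq; [apply Z_sym, pr_Z; auto|]. apply pr_len.
Qed.

Lemma pr_L o x : L o x (pr o x).
Proof.
destruct (classic (x = o)) as [->|H]; [col|]. assert (K := pr_Z H). col.
Qed.

Lemma pr_conj f o x : motion f -> f (pr o x) = pr (f o) (f x).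
Proof.
intros M. destruct (classic (x = o)) as [->|H]; [rewrite !pr_o; reflexivity|].
symmetry. apply pr_eq; [apply M, pr_Z; auto|].
rewrite !(motion_isometry M). symmetry. apply pr_len.
Qed.

Lemma Rt_refl_pr a o w x : Rt a o w -> L o a x -> refl o w x = pr o x.
Proof.
intros R K. destruct (classic (x = o)) as [->|xo].
{ rewrite pr_o. apply refl_on. col. }
assert (Rx : Rt x o w) by (apply (@Rt_extend a); auto).
apply Rt_sym in Rx. destruct Rx as [ow [_ [x' [H [E1 E2]]]]].
rewrite (pr_eq H E1). zneq. apply refl_eq; auto.
Qed.

(** The product f of the two reflections agrees with [pr o] on both axes, so it is an involution by
    rigidity, and its only fixed point is o. It remains to see that x, o, f x are collinear. *)
Lemma pr_comp a o w x : Rt a o w -> pr o x = refl o a (refl o w x).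
Proof.
intros R. assert (R' := Rt_sym R). assert (N := Rt_noncol R).
assert (oa : o <> a) by apply R. assert (ow : o <> w) by apply R.
set (f := fun x => refl o a (refl o w x)).
assert (If : isometry f) by exact (isometry_comp (refl_isometry oa) (refl_isometry ow)).
assert (fo : f o = o) by (unfold f; rewrite (@refl_on o w o), (@refl_on o a o); auto; col).
assert (fa : forall y, L o a y -> f y = pr o y).
{ intros y Ly. unfold f. rewrite (Rt_refl_pr R Ly).
  apply refl_on. assert (K := pr_L o y).
  destruct (classic (y = o)) as [->|yo]; [rewrite pr_o; col|col2]. }
assert (fw : forall y, L o w y -> f y = pr o y).
{ intros y Ly. unfold f. rewrite (refl_on Ly). apply (Rt_refl_pr R'). exact Ly. }
assert (Fix : forall y, f y = y -> y = o).
{ intros y Q. apply NNPP. intros yo.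
  assert (Ey : forall u, len y u = len y (f u)) by (intros u; rewrite <- Q at 2; rewrite If; auto).
  assert (Lw : L o w y).
  { apply NNPP. intros G. assert (E : a = pr o a).
    { apply (@equidistant_3 o w y); auto.
      - rewrite pr_len; auto.
      - rewrite <- (Rt_refl_pr R) by col. rewrite refl_dist; auto. col.
      - rewrite <- fa; [auto|col]. }
    assert (K := @pr_Z o a (not_eq_sym oa)). rewrite <- E in K. exact (Z_neq13 K eq_refl). }
  assert (La : L o a y).
  { apply NNPP. intros G. assert (E : w = pr o w).
    { apply (@equidistant_3 o a y); auto.
      - rewrite pr_len; auto.
      - rewrite <- (Rt_refl_pr R') by col. rewrite refl_dist; auto. col.
      - rewrite <- fw; [auto|col]. }
    assert (K := @pr_Z o w (not_eq_sym ow)). rewrite <- E in K. exact (Z_neq13 K eq_refl). }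
  apply N. col2. }
assert (ff : forall y, f (f y) = y).
{ intros y. apply (@isometry_rigid (fun y => f (f y)) (fun y => y) o a w).
  - exact (isometry_comp If If).
  - intros ? ?; reflexivity.
  - rewrite fo, fo, (fa a), (fw w) by col. rewrite (fa (pr o a)), (fw (pr o w)) by apply pr_L.
    rewrite !pr_invol. exact N.
  - rewrite fo; auto.
  - rewrite (fa a) by col. rewrite fa by (assert (K := pr_L o a); col). apply pr_invol.
  - rewrite (fw w) by col. rewrite fw by (assert (K := pr_L o w); col). apply pr_invol. }
destruct (classic (x = o)) as [->|xo].
{ rewrite pr_o. symmetry. exact fo. }
fold (f x).
assert (E : len o x = len o (f x)) by (rewrite <- fo at 2; rewrite If; auto).
assert (xfx : x <> f x) by (intros Q; apply xo, Fix; auto).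
(* Otherwise the reflection k that exchanges x and f x would coincide with f, and f would fix the
   whole line ot. *)
assert (K : L o x (f x)).
{ apply NNPP. intros M.
  destruct (bisector_noncol M E) as [t [ot [Qt _]]].
  apply ot. symmetry. apply Fix.
  set (k := refl o t) in *. assert (Ik : isometry k) by (apply refl_isometry; auto).
  assert (ko : k o = o) by (apply refl_on; col).
  assert (kfx : k (f x) = x) by (rewrite <- Qt; apply refl_invol; auto).
  assert (kf : forall y, k (f y) = y).
  { apply (@isometry_rigid (fun y => k (f y)) (fun y => y) o x (f x)).
    - exact (isometry_comp Ik If).
    - intros ? ?; reflexivity.
    - rewrite fo, ko, kfx, ff, Qt. exact M.
    - rewrite fo; auto.
    - exact kfx.
    - rewrite ff. exact Qt. }
  assert (kt : k t = t) by (apply refl_on; col).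
  apply (isometry_inj Ik). rewrite kf. auto. }
apply pr_eq; auto.
apply NNPP. intros Q. apply xfx. apply (@ray_unique o); auto.
Qed.

Lemma motion_pr o : motion (pr o).
Proof.
destruct (dimension_ge2 HP) as [u [v [w N]]].
assert (H : exists a, a <> o).
{ destruct (classic (u = o)) as [->|]; [exists v|exists u; auto].
  intros ->. apply N. col. }
destruct H as [a ao]. destruct (@Rt_erect a o ao) as [b R].
assert (oa : o <> a) by auto. assert (ob : o <> b) by apply R.
assert (M := motion_comp (motion_refl oa) (motion_refl ob)).
assert (E : pr o = fun x => refl o a (refl o b x)).
{ extensionality x. apply pr_comp; auto. }
rewrite E. exact M.
Qed.

Lemma pr_mid_unique u v x : pr u x = pr v x -> u = v.
Proof.
intros E. apply NNPP. intros uv.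
destruct (classic (x = u)) as [->|xu].
{ assert (H := pr_Z uv). rewrite <- E, pr_o in H. exact (Z_neq13 H eq_refl). }
destruct (classic (x = v)) as [->|xv].
{ assert (H := @pr_Z u v). rewrite E, pr_o in H. exact (Z_neq13 (H xu) eq_refl). }
assert (Hu := pr_Z xu). assert (Hv := pr_Z xv). rewrite <- E in Hv.
apply (Z_neq13 Hu). apply (@line_point_unique u v); auto; try (zneq; col2).
- rewrite pr_len; auto.
- rewrite E, pr_len; auto.
Qed.

Lemma pr_OS a b o x : a <> b -> L a b o -> ~ L a b x -> OS a b x (pr o x).
Proof.
intros ab Lo N. apply (@OS_of_Z a b x o); auto. apply pr_Z. congruence.
Qed.

Lemma refl_OS a b x : a <> b -> ~ L a b x -> OS a b x (refl a b x).
Proof.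
intros ab N. destruct (refl_foot ab N) as [f [Lf Zf]]. apply (@OS_of_Z a b x f); auto.
Qed.

Lemma pr_col a b v x : a <> b -> L a b v -> L a b x -> L a b (pr v x).
Proof.
intros ab Lv Lx. destruct (classic (x = v)) as [->|xv]; [rewrite pr_o; auto|].
assert (K := pr_L v x). col2.
Qed.

Lemma pr_neq v x y : x <> y -> pr v x <> pr v y.
Proof. intros N Q. apply N. rewrite <- (pr_invol v x), Q. apply pr_invol. Qed.

Lemma pr_anti a b v x y : a <> b -> L a b v -> L a b x -> L a b y ->
  lt a b x y -> lt a b (pr v y) (pr v x).
Proof.
intros ab Lv Lx Ly H.
assert (xy : x <> y) by (intros ->; exact (lt_irrefl H)).
assert (xy' := @pr_neq v x y xy).
assert (Hx := pr_spec v x). assert (Hy := pr_spec v y).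
assert (M := motion_pr v).
assert (C1 : Z x y v -> Z (pr v x) (pr v y) v).
{ intros Q. rewrite <- (pr_o v) at 3. apply M. exact Q. }
assert (C2 : Z y x v -> Z (pr v y) (pr v x) v).
{ intros Q. rewrite <- (pr_o v) at 3. apply M. exact Q. }
assert (Lx' := pr_col ab Lv Lx). assert (Ly' := pr_col ab Lv Ly).
set (x' := pr v x) in *. set (y' := pr v y) in *. clearbody x' y'.
assert (Gx : (x = v /\ x' = v) \/ Z x v x') by tauto.
assert (Gy : (y = v /\ y' = v) \/ Z y v y') by tauto.
clear Hx Hy. ord a b (x :: y :: x' :: y' :: v :: nil).
Qed.

(** The product f reverses the order on ab and exchanges its sides. From this it follows that f is
    an involution on w, f w and a point i off the line; then the point e where the line joins i to f
    i is the centre. *)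
Lemma three_points a b u v w : a <> b -> L a b u -> L a b v -> L a b w ->
  exists e, L a b e /\ forall x, pr u (pr v (pr w x)) = pr e x.
Proof.
intros ab Lu Lv Lw.
set (f := fun x => pr u (pr v (pr w x))).
assert (Mf : motion f) by exact (motion_comp (motion_pr u) (motion_comp (motion_pr v) (motion_pr w))).
assert (If := motion_isometry Mf).
set (c := f w).
assert (Lf : forall x, L a b x -> L a b (f x)) by (intros; repeat apply pr_col; auto).
assert (Lc : L a b c) by (apply Lf; auto).
destruct (classic (c = w)) as [cw|cw].
{ assert (uv : u = v).
  { apply (@pr_mid_unique u v w). unfold c, f in cw. rewrite pr_o in cw.
    rewrite <- cw at 1. apply pr_invol. }
  exists w. split; auto. intros x. rewrite uv. apply pr_invol. }
(* Since f preserves length, the alternative is that c lies between w and f c, as under a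
   translation; reversal of order excludes it. *)
assert (fc : f c = w).
{ apply NNPP. intros Q.
  assert (K : Z w c (f c)).
  { apply NNPP. intros K. apply Q. symmetry. apply (@ray_unique c); auto.
    - apply (@L_line a b); auto.
    - change (len c (f c)) with (len (f w) (f c)). rewrite If. apply len_sym. }
  assert (A : forall x y, L a b x -> L a b y -> lt a b x y -> lt a b (f y) (f x)).
  { intros x y Lx Ly H. unfold f. repeat (apply pr_anti; auto; try (apply pr_col; auto)).
    apply pr_col; auto. apply pr_col; auto. }
  assert (Lfc : L a b (f c)) by (apply Lf; auto).
  destruct (@lt_total a b w c) as [H|H]; auto.
  - assert (H' := A w c Lw Lc H). change (f w) with c in H'.
    ord a b (w :: c :: f c :: nil).
  - assert (H' := A c w Lc Lw H). change (f w) with c in H'.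
    ord a b (w :: c :: f c :: nil). }
destruct (off_line ab) as [i Ni].
assert (wc : w <> c) by auto.
assert (Ni' : ~ L w c i) by (intros Q; apply Ni; col2).
assert (O : forall o x, L a b o -> ~ L a b x -> OS a b x (pr o x)) by (intros; apply pr_OS; auto).
assert (ON : forall o x, L a b o -> ~ L a b x -> ~ L a b (pr o x)).
{ intros o x Lo Nx. apply (O o x Lo Nx). }
assert (Of : forall x, ~ L a b x -> OS a b x (f x)).
{ intros x Nx. assert (N1 := ON w x Lw Nx). assert (N2 := ON v _ Lv N1).
  apply OS_sym. apply (@OS_SS a b _ (pr v (pr w x))).
  - apply OS_sym, O; auto.
  - apply SS_sym. apply (@OS_OS a b x (pr w x)); apply O; auto. }
assert (ffi : f (f i) = i).
{ assert (Ni2 : ~ L a b (f (f i))) by (apply Of, Of; auto).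
  apply NNPP. intros Q.
  assert (E : refl a b i = f (f i)).
  { rewrite <- (@refl_line a b w c i) by auto. apply refl_eq; auto.
    - transitivity (len (f (f w)) (f (f i))); [rewrite !If; auto|].
      change (f (f w)) with (f c). rewrite fc. reflexivity.
    - transitivity (len (f (f c)) (f (f i))); [rewrite !If; auto|].
      rewrite fc. reflexivity. }
  apply (@OS_not_SS a b i (f (f i))).
  - rewrite <- E. apply refl_OS; auto.
  - apply (@OS_OS a b i (f i)); apply Of; auto. }
destruct (Of i Ni) as [_ [Nfi [e [Le Ze]]]].
assert (fe : f e = e).
{ assert (K : Z (f i) (f e) i) by (rewrite <- ffi at 2; apply Mf; auto).
  assert (Lfe : L a b (f e)) by (apply Lf; auto).
  apply NNPP. intros Q. apply Ni. zneq. assert (L e (f e) i) by col2.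
  apply (@L_line e (f e)); auto; apply (@L_line a b); auto; col. }
exists e. split; auto.
assert (Ewc : len e w = len e c) by (rewrite <- fe at 2; change c with (f w); rewrite If; auto).
assert (Zwc : Z w e c).
{ apply NNPP. intros Q. apply cw. symmetry. apply (@ray_unique e); auto. apply (@L_line a b); auto. }
assert (Ei : len e i = len e (f i)) by (rewrite <- fe at 2; rewrite If; auto).
intros x. fold (f x).
apply (@isometry_rigid f (pr e) w c i); auto.
- apply motion_isometry, motion_pr.
- rewrite fc. fold c. intros Q. apply Nfi. apply (@L_line w c); auto; try col.
  all: apply (@L_line a b); auto; col.
- symmetry. apply pr_eq; auto.
- rewrite fc. symmetry. apply pr_eq; auto using Z_sym.
- symmetry. apply pr_eq; auto.
Qed.

(* A translation along ab moves i parallel to ab: both lines are perpendicular to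
   the mirror that takes i to its image. *)
Lemma translation_disjoint a b u v i z : a <> b -> L a b u -> L a b v -> u <> v ->
  ~ L a b i -> L a b z -> ~ L i (pr u (pr v i)) z.
Proof.
intros ab Lu Lv uv Ni Lz H.
destruct (foot_ex ab Ni) as [n [Ln [ni Rn]]].
(* n is the foot of i, so [pr n] and the mirror ab act alike on i. The translation thus takes i to
   the image under [pr e] of its mirror image in ab, which is the mirror image of i in the
   perpendicular to ab at e. *)
destruct (three_points ab Lu Lv Ln) as [e [Le Ee]].
assert (Ein : pr n i = refl a b i).
{ destruct (other_point ab Ln) as [x [Lx xn]].
  assert (R := Rt_sym (Rn x Lx xn)).
  rewrite <- (@Rt_refl_pr i n x i) by (auto; col). apply refl_line; auto. }
assert (Ei : pr u (pr v i) = pr e (refl a b i)).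
{ rewrite <- Ee, <- Ein, pr_invol. reflexivity. }
destruct (other_point ab Le) as [x [Lx xe]].
destruct (Rt_erect xe) as [w R].
assert (ew : e <> w) by apply R.
assert (Er : pr u (pr v i) = refl e w i).
{ rewrite Ei. rewrite (pr_comp _ (Rt_sym R)). f_equal.
  rewrite (@refl_line a b e x) by auto. apply refl_invol; auto. }
assert (Nx : ~ L e w x) by (intros Q; apply (Rt_noncol R); col).
assert (Ex : refl e w x = pr e x) by (apply (Rt_refl_pr R); col).
assert (Zx := pr_Z xe).
assert (Niw : ~ L e w i).
{ intros Q. apply uv. apply (@pr_mid_unique u v (pr v i)).
  rewrite pr_invol, Er. apply refl_on; auto. }
apply Ni.
assert (K : L x (refl e w x) i).
{ apply (@perpendiculars_eq e w x i z); auto.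
  - rewrite Ex. assert (L a b (pr e x)) by (apply pr_col; auto). apply (@L_line a b); auto.
  - rewrite <- Er. exact H. }
rewrite Ex in K. zneq. apply (@L_line x (pr e x)); auto.
all: apply (@L_line a b); auto; try col; apply pr_col; auto.
Qed.

Lemma Rt_disjoint f g x y z : f <> g -> Rt f g x -> Rt g f y -> L g x z -> ~ L f y z.
Proof.
intros fg R1 R2 H1 H2.
assert (N1 := Rt_noncol R1). assert (N2 := Rt_noncol R2).
assert (zg : z <> g).
{ intros ->. apply N2. destruct R2 as [_ [fy _]]. col2. }
assert (zf : z <> f).
{ intros ->. apply N1. destruct R1 as [_ [gx _]]. col2. }
apply (@Rt_two f g z).
- apply Rt_sym, (@Rt_extend x); auto. apply Rt_sym; auto.
- apply Rt_sym, (@Rt_extend y); auto. apply Rt_sym; auto.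
Qed.

(** Doubling is monotone since a translation cannot push a segment into itself. Otherwise f = [pr m]
    after [pr q] takes q, x to A, o in the order q, A, o, x. The perpendicular at o meets qz in a
    point k, where xz is perpendicular to qx, and each position of k relative to z' = f z
    contradicts [translation_disjoint] or the sides of qx. *)
Lemma pr_mono y q m : Z y q m -> Z y (pr q y) (pr m y).
Proof.
intros H. zneq. apply NNPP. intros C.
set (x := pr q y) in *. set (o := pr m y) in *.
assert (Zx : Z y q x) by (apply pr_Z; auto).
assert (Zo : Z y m o) by (apply pr_Z; auto).
assert (qm : q <> m) by auto.
assert (xo : x <> o).
{ intros Q. apply qm. apply (@pr_mid_unique q m y). exact Q. }
set (A := pr m q). assert (ZA : Z q m A) by (apply pr_Z; auto).
assert (ZoA : Z o A m).
{ unfold o, A. rewrite <- (pr_o m) at 3. apply (motion_pr m). exact H. }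
zneq.
assert (Ord : Z q A o /\ Z q o x /\ Z A o x).
{ repeat split; ord y q (y :: q :: m :: x :: o :: A :: nil). }
destruct Ord as [O1 [O2 O3]]. zneq.
assert (qx : q <> x) by auto.
destruct (@Rt_erect q x qx) as [z R].
set (f := fun t => pr m (pr q t)).
assert (Mf : motion f) by exact (motion_comp (motion_pr m) (motion_pr q)).
assert (fx : f x = o) by (unfold f, x; rewrite pr_invol; reflexivity).
assert (fq : f q = A) by (unfold f; rewrite pr_o; reflexivity).
assert (Lqm : L q x m) by col2. assert (Lqo : L q x o) by col. assert (LqA : L q x A) by col2.
assert (Nz : ~ L q x z) by (intros Q; apply (Rt_noncol R); col).
set (z' := f z).
assert (mq : m <> q) by auto.
assert (Nz' : ~ L q x z').
{ intros Q. apply Nz. rewrite <- (motion_L q x z Mf), fq, fx.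
  apply (@L_line q x); auto. }
assert (Szz : SS q x z z').
{ apply (@OS_OS q x z (pr q z)); [apply pr_OS; auto; col|].
  apply pr_OS; auto. apply (@pr_OS q x q z); auto. col. }
assert (D : forall t, ~ L q x t -> forall s, L q x s -> ~ L t (f t) s).
{ intros t Nt s Ls. apply (@translation_disjoint q x m q t s); auto. col. }
assert (Ro : forall t, L q x t -> t <> o -> Rt t o z').
{ intros t Lt to. 
  assert (Rq : Rt A o z').
  { destruct R as [r1 [r2 [z2 [r3 [r4 r5]]]]].
    assert (If := motion_isometry Mf).
    repeat split; auto. intros Q; apply Nz'; rewrite <- Q; auto.
    exists (f z2). unfold z'. rewrite <- fx, <- fq. rewrite !If.
    repeat split; auto. apply Mf; auto. }
  apply (@Rt_extend A); auto. apply (@L_line q x); auto. }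
assert (oz' : o <> z') by (intros Q; apply Nz'; rewrite <- Q; auto).
assert (xz : x <> z) by apply R. assert (qz : q <> z) by (intros Q; apply Nz; rewrite <- Q; col).
assert (Rq' : Rt q o z') by (apply Ro; auto; col).
assert (Rx' : Rt x o z') by (apply Ro; auto; col).
assert (Nqo : ~ L o z' q) by (intros Q; apply (Rt_noncol Rq'); col).
assert (Nxo : ~ L o z' x) by (intros Q; apply (Rt_noncol Rx'); col).
assert (Rox : Rt o x z) by (apply (@Rt_extend q); auto; col).
assert (Dis : forall t, L x z t -> ~ L o z' t).
{ intros t Lt. apply (@Rt_disjoint o x z z' t); auto. }
assert (OS1 : OS o z' q x) by (apply (@OS_of_Z o z' q o x); auto; col).
assert (SS1 : SS o z' x z).
{ destruct (@SS_or_OS o z' x z) as [?|[_ [_ [t [Lt Zt]]]]]; auto.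
  - apply Dis. col.
  - destruct (Dis t); auto. col. }
destruct (OS_SS OS1 SS1) as [_ [_ [k [Lk Zk]]]]. zneq.
assert (Sk : SS q x k z').
{ apply (@SS_trans q x k z); auto. apply SS_sym, (@SS_ray q x q z k); auto; try col.
  zno. }
assert (ok : o <> k) by (intros Q; apply (proj1 Sk); rewrite <- Q; auto).
destruct (classic (k = z')) as [kz|kz].
{ apply (D z Nz q); [col|]. fold z'. rewrite <- kz. col. }
destruct (@L_cases o k z') as [Q|[Q|Q]]; auto; try col.
- (* j = qz and its image A z' cross *)
  assert (Nj : ~ L q z o) by (intros G; apply Nz; col2).
  assert (OSj : OS q z o z') by (apply (@OS_of_Z q z o k z'); auto; col).
  assert (SSj : SS q z o A).
  { apply (@SS_ray q z q o A); auto; try col.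
    zno. }
  destruct (OS_SS (OS_sym OSj) SSj) as [_ [_ [i [Li Zi]]]].
  zneq. set (i0 := pr q (pr m i)).
  assert (fi : f i0 = i) by (unfold f, i0; rewrite !pr_invol; reflexivity).
  assert (Ni : ~ L q x i) by (intros G; apply Nz'; col2).
  assert (Li0 : L q z i0).
  { rewrite <- (motion_L q z i0 Mf), fi, fq. fold z'. col. }
  assert (Ni0 : ~ L q x i0).
  { intros G. apply Ni. rewrite <- fi. unfold f. apply pr_col; auto. apply pr_col; auto. col. }
  apply (D i0 Ni0 q); [col|]. rewrite fi.
  assert (i0 <> i).
  { intros G. apply qm, (@pr_mid_unique q m i0).
    assert (E : pr m (pr q i0) = i0) by (rewrite G at 2; exact fi).
    rewrite <- E at 2. rewrite pr_invol. reflexivity. }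
  col2.
- (* the line zz' meets the line qo *)
  assert (zz : z <> z').
  { intros G. apply (D z Nz q); [col|]. fold z'. rewrite <- G. col. }
  assert (Nzo : ~ L z z' o) by (apply (D z Nz o); col).
  assert (OSz : OS z z' o k) by (apply (@OS_of_Z z z' o z' k); auto using Z_sym; col).
  assert (SSz : SS z z' k q).
  { apply (@SS_ray z z' z k q); auto; try col; [apply OSz|].
    zno. }
  destruct (OS_SS OSz SSz) as [_ [_ [t [Lt Zt]]]].
  apply (D z Nz t); [zneq; col2|]. exact Lt.
- apply (@OS_not_SS q x k z'); auto.
  apply (@OS_of_Z q x k o z'); auto using Z_sym. apply Sk.
Qed.

(** * Circles and tangents *)

Lemma SS_between a b p q r : SS a b p r -> Z p q r -> SS a b p q.
Proof.
intros H K. assert (ab := SS_neq H). pose proof H as [Np [Nr O]].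
assert (Nq : ~ L a b q).
{ intros Q. apply O. repeat split; auto. exists q; auto. }
destruct (SS_or_OS Np Nq) as [?|[_ [_ [z [Lz Zz]]]]]; auto.
exfalso. apply O. repeat split; auto. exists z. split; auto.
exact (proj2 (Z_trans1 Zz K)).
Qed.

(** For z off vy, the midpoint q of the chord yz has an altitude foot c between v and y. The line cq
    is perpendicular to vy and so misses the tangent; hence v, c, q, z follow each other on one side
    of it. *)
Lemma tangent_side v y w z : Rt v y w -> len v z = len v y -> z <> y -> SS y w v z.
Proof.
intros R E zy.
assert (N : ~ L y w v) by (intros Q; apply (Rt_noncol R); col).
assert (yv : y <> v) by apply R. assert (yw : y <> w) by apply R.
destruct (classic (L v y z)) as [K|K].
{ assert (H : Z y v z).
  { apply NNPP. intros Q. apply zy. symmetry. apply (@ray_unique v); auto. }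
  apply (@SS_ray y w y v z); auto; try col.
  zno. }
destruct (@bisector_noncol v y z K) as [t [vt [Et _]]]; auto.
assert (Ny : ~ L v t y).
{ intros Q. rewrite (refl_on Q) in Et. auto. }
destruct (refl_foot vt Ny) as [q [Lq Zq]]. rewrite Et in Zq. zneq.
assert (qv : q <> v) by (intros ->; apply K; col).
assert (Rq : Rt y q v).
{ apply Rt_sym, (@refl_Rt v t y q v); auto; try col. rewrite Et. col. }
destruct (altitude Rq) as [c [Zc [Rc _]]]. zneq.
assert (D : forall u, L y w u -> ~ L c q u).
{ intros u. apply (@Rt_disjoint c y w q u); auto.
  - apply (@Rt_extend v); auto. col.
  - apply Rt_sym; auto. }
assert (Nc : ~ L y w c) by (intros Q; apply (D c Q); col).
assert (Nq : ~ L y w q) by (intros Q; apply (D q Q); col).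
assert (S1 : SS y w v c).
{ apply (@SS_ray y w y v c); auto; try col. zno. }
assert (S2 : SS y w c q).
{ destruct (SS_or_OS Nc Nq) as [?|[_ [_ [u [Lu Zu]]]]]; auto.
  destruct (D u Lu). col. }
assert (S3 : SS y w q z).
{ apply (@SS_ray y w y q z); auto; try col. zno. }
apply (SS_trans S1 (SS_trans S2 S3)).
Qed.

(* x lies inside the circle with centre v through y, expressed by its tangents. *)
Definition inside v y x :=
  forall y' w, len v y' = len v y -> Rt v y' w -> SS y' w v x.

Lemma inside_chord v y y0 x : len v y0 = len v y -> Z y x y0 -> inside v y x.
Proof.
intros E H y' w E' R. zneq.
assert (T : forall u, len v u = len v y -> u <> y' -> SS y' w v u).
{ intros u Eu uy. apply tangent_side; auto. congruence. }
assert (yw : y' <> w) by apply R.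
destruct (classic (y' = y)) as [->|yy].
- assert (S := T y0 E ltac:(auto)). apply (SS_trans S).
  apply (@SS_ray y w y y0 x); auto; try col; [apply S|].
  zno.
- destruct (classic (y' = y0)) as [->|yy0].
  + assert (S := T y eq_refl ltac:(auto)). apply (SS_trans S).
    apply (@SS_ray y0 w y0 y x); auto; try col; [apply S|].
    zno.
  + assert (S := T y eq_refl ltac:(auto)). apply (SS_trans S).
    apply (@SS_between y' w y x y0); auto.
    apply (@SS_trans y' w y v); auto using SS_sym.
Qed.

Lemma foot_or_on x y v : x <> y -> exists f, L x y f /\
  (f = v \/ f <> v /\ forall p, L x y p -> p <> f -> Rt p f v).
Proof.
intros xy. destruct (classic (L x y v)) as [K|K].
- exists v; auto.
- destruct (foot_ex xy K) as [f [H1 [H2 H3]]]. exists f; auto.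
Qed.

Lemma len_pr_foot f p v : (f = v \/ f <> v /\ (p <> f -> Rt p f v)) ->
  len v (pr f p) = len v p.
Proof.
intros [->|[_ H]]; [apply pr_len|].
destruct (classic (p = f)) as [->|pf]; [rewrite pr_o; auto|].
assert (R := Rt_sym (H pf)). destruct R as [_ [_ [p' [K1 [K2 K3]]]]].
rewrite (pr_eq K1 K2). auto.
Qed.

(* If v is nearer to x than to y, then x lies inside the circle around v through y. *)
Lemma inside_of_side n w v x y : refl n w y = x -> SS n w v x -> inside v y x.
Proof.
intros E S. assert (nw := SS_neq S).
assert (Ny : ~ L n w y).
{ intros Q. rewrite (refl_on Q) in E. subst x. exact (proj1 (proj2 S) Q). }
destruct (refl_foot nw Ny) as [q [Lq Zq]]. rewrite E in Zq. zneq.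
assert (Eq : len q y = len q x) by (rewrite <- E, refl_dist; auto).
assert (Ex : pr q y = x) by (apply pr_eq; auto).
assert (xy : x <> y) by auto.
destruct (foot_or_on v xy) as [f [Lf Hf]].
(* The mirror and the perpendicular from v to xy are both perpendicular to xy and do not meet. So f
   lies with v, across the mirror from y. *)
assert (Oyf : OS n w y f).
{ assert (Oyv : OS n w y v).
  { apply (@OS_SS n w y x v); auto using SS_sym. apply (@OS_of_Z n w y q x); auto. }
  destruct Hf as [->|[fv Rf]]; auto.
  destruct (other_point nw Lq) as [e [Le eq]].
  assert (Re : Rt e q y).
  { apply (@refl_Rt n w); auto. rewrite E. col. }
  assert (fq : f <> q).
  { intros ->. apply (proj1 S). assert (R1 := Rf y ltac:(col) ltac:(auto)).
    assert (L q v e) by (apply (@Rt_unique y); auto using Rt_sym). col2. }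
  assert (D : forall z, L q e z -> ~ L f v z).
  { intros z. apply (@Rt_disjoint f q e v z); auto.
    - apply (@Rt_extend y); [apply Rt_sym; auto|col2|auto].
    - apply Rf; auto. col. }
  assert (Nf : ~ L n w f) by (intros Q; apply (D f); [col2|col]).
  apply (@OS_SS n w y v f); auto.
  destruct (@SS_or_OS n w v f) as [?|[_ [_ [u [Lu Zu]]]]]; auto; [apply S|].
  destruct (D u); [col2|zneq; col]. }
assert (Zf : Z y q f) by (apply (@Z_of_OS n w); auto; col2).
(* The image x of y in q comes before its image in f. The latter is on the circle, so x is on a
   chord. *)
assert (M := pr_mono Zf). rewrite Ex in M.
apply (@inside_chord v y (pr f y)); auto.
apply len_pr_foot. destruct Hf as [Hf|[fv Rf]]; auto. right; split; auto.
intros; apply Rf; auto. col.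
Qed.

Lemma inside_len v y z x : len v y = len v z -> inside v y x -> inside v z x.
Proof. intros E H y' w E' R. apply H; auto. congruence. Qed.

Lemma inside_beyond v y' y x : v <> y' -> len v y' = len v y -> inside v y x -> ~ Z v y' x.
Proof.
intros vy E H K. destruct (Rt_erect vy) as [w R].
assert (S := H y' w E R). zneq.
apply (OS_not_SS (a:=y') (b:=w) (x:=v) (y:=x)); auto.
apply (@OS_of_Z y' w v y' x); auto; [apply R|apply S|col].
Qed.

Lemma inside_neq v y x : v <> x -> inside v y x -> len v x <> len v y.
Proof.
intros vx H E. destruct (Rt_erect vx) as [w R]. apply (proj1 (proj2 (H x w E R))). col.
Qed.

Lemma inside_antisym v x y : v <> x -> v <> y -> inside v x y -> ~ inside v y x.
Proof.
intros vx vy H1 H2.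
assert (xy : x <> y).
{ intros <-. exact (inside_neq vx H1 eq_refl). }
destruct (foot_or_on v xy) as [f [Lf Hf]].
assert (Hl : forall p, L x y p -> len v (pr f p) = len v p).
{ intros p Lp. apply len_pr_foot. destruct Hf as [Hf|[fv Rf]]; auto. }
(* The tangent at p has f on the side of v, so a point of the line inside the circle through p is
   not beyond p as seen from f. Applied to x, y and their images in f, this leaves no possible
   order. *)
assert (A : forall p r, L x y p -> v <> p -> inside v p r -> L x y r -> r <> p ->
  p <> f /\ ~ Z f p r).
{ intros p r Lp vp H Lr rp.
  assert (pf : p <> f).
  { intros ->. destruct Hf as [->|[fv Rf]]; [congruence|].
    assert (R := Rt_sym (Rf r Lr rp)).
    apply (proj1 (proj2 (H f r eq_refl R))). col. }
  split; auto. intros K.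
  destruct (Rt_erect vp) as [w R].
  assert (S := H p w eq_refl R).
  assert (pw : p <> w) by apply R.
  assert (Sf : SS p w v f).
  { destruct Hf as [->|[fv Rf]]; [apply SS_refl, S|].
    assert (Zp := pr_Z pf). zneq.
    assert (T : SS p w v (pr f p)) by (apply tangent_side; auto).
    apply (SS_trans T). apply (@SS_ray p w p (pr f p) f); auto; try col; [apply T|].
    zno. }
  apply (@OS_not_SS p w f r).
  - apply (@OS_of_Z p w f p r); auto; [apply Sf|col].
  - apply (SS_trans (SS_sym Sf) S). }
set (x0 := pr f x). set (y0 := pr f y).
assert (Lx0 : L x y x0) by (apply pr_col; auto; col).
assert (Ly0 : L x y y0) by (apply pr_col; auto; col).
assert (Ex0 : len v x0 = len v x) by (apply Hl; col).
assert (Ey0 : len v y0 = len v y) by (apply Hl; col).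
assert (vx0 : v <> x0).
{ intros <-. apply vx. symmetry. apply (@len_eq x v v). cg. }
assert (vy0 : v <> y0).
{ intros <-. apply vy. symmetry. apply (@len_eq y v v). cg. }
assert (x0y : x0 <> y).
{ intros Q. apply (inside_neq vy H1). congruence. }
assert (y0x : y0 <> x).
{ intros Q. apply (inside_neq vx H2). congruence. }
destruct (A x y) as [xf A1]; auto; try col.
destruct (A y x) as [yf A2]; auto; try col.
destruct (A x0 y) as [_ A3]; auto; try col. { apply (@inside_len v x); auto. }
destruct (A y0 x) as [_ A4]; auto; try col. { apply (@inside_len v y); auto. }
assert (Zx := pr_Z xf). assert (Zy := pr_Z yf). fold x0 in Zx. fold y0 in Zy.
assert (A5 : Z f y x0 -> Z f y0 x).
{ intros Q. apply (motion_pr f) in Q. rewrite pr_o in Q. unfold x0 in Q.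
  rewrite pr_invol in Q. exact Q. }
clear A Hl. clearbody x0 y0.
ord x y (x :: y :: f :: x0 :: y0 :: nil).
Qed.

Lemma SS_l a b x y : SS a b x y -> ~ L a b x.
Proof. intros H. apply H. Qed.
Lemma SS_r a b x y : SS a b x y -> ~ L a b y.
Proof. intros H. apply SS_sym in H. apply H. Qed.

Lemma Rt_motion f x o y : motion f -> Rt x o y -> Rt (f x) (f o) (f y).
Proof.
intros M [H1 [H2 [y' [H3 [H4 H5]]]]]. assert (I := motion_isometry M).
repeat split; try (intros Q; apply (isometry_inj I) in Q; auto; fail).
exists (f y'). rewrite !I. repeat split; auto. apply M; auto.
Qed.

(** * Triangles with cevians through a point of the bisector *)

(** With r' on the prolongation of rc, suppose cq separated r' from p at t. Being on the side of p,
    hence of q, of cr, t is on the ray cq and so on the side of q of cp; yet t is also on the side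
    of r', which is the other one. *)
Lemma crossbar c p q r : SS c p q r -> SS c r q p -> OS c q p r.
Proof.
intros H1 H2.
assert (cp := SS_neq H1). assert (cr := SS_neq H2).
assert (Nq := SS_l H1). assert (Nr := SS_r H1). assert (Nq' := SS_l H2).
assert (cq : c <> q) by (intros <-; apply Nq; col).
assert (Np : ~ L c q p) by (intros Q; apply Nq; col).
assert (Nr' : ~ L c q r) by (intros Q; apply Nq'; col).
set (r' := pr c r). assert (rc : r <> c) by auto.
assert (Zr := pr_Z rc). fold r' in Zr. zneq.
assert (Orr : OS c q r r') by (apply (@OS_of_Z c q r c r'); auto; col).
assert (Nr2 : ~ L c q r') by (intros Q; apply Nr'; col2).
apply OS_sym, (@OS_SS c q r r' p); auto.
destruct (@SS_or_OS c q r' p) as [?|[_ [_ [t [Lt Zt]]]]]; auto. exfalso.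
zneq.
assert (S1 : SS c r t p).
{ apply SS_sym. assert (SS r' c p t); [|apply (@SS_line r' c); auto; col].
  apply (@SS_ray r' c r' p t); auto; try col.
  - intros Q. apply (SS_r H2). col2.
  - zno. }
assert (ct : c <> t).
{ intros <-. apply (SS_l S1). col. }
assert (Ztq : ~ Z t c q).
{ intros Q. apply (@OS_not_SS c r t q).
  - apply (@OS_of_Z c r t c q); auto; [apply (SS_l S1)|col].
  - apply (SS_trans S1 (SS_sym H2)). }
assert (S2 : SS c p t q).
{ apply SS_sym, (@SS_ray c p c q t); auto; try col.
  intros Q. apply Ztq. apply Z_sym; auto. }
assert (Orp : OS c p r r') by (apply (@OS_of_Z c p r c r'); auto; col).
assert (S3 : SS c p r' t).
{ assert (SS p c r' t); [|apply (@SS_line p c); auto; col].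
  apply (@SS_ray p c p r' t); auto; try col.
  - intros Q. apply Nr. col2.
  - zno. }
apply (@OS_not_SS c p r r'); auto.
apply SS_sym, (SS_trans S3). apply (SS_trans S2 H1).
Qed.

(* Otherwise c would lie inside the circle around a through b, but it lies beyond the
   point d of this circle. *)
Lemma apex_side a b c d o w : ~ L a b c -> len a d = len a b -> Z a d c ->
  refl o w b = c -> o <> w -> SS o w a b.
Proof.
intros N E H R ow. zneq.
assert (bc : b <> c) by (intros <-; apply N; col).
assert (Nb : ~ L o w b) by (intros Q; rewrite (refl_on Q) in R; auto).
assert (Obc : OS o w b c) by (rewrite <- R; apply refl_OS; auto).
assert (Na : ~ L o w a).
{ intros Q. assert (d = c); [|auto]. apply (@ray_unique a); [col| |].
  - zno.
  - rewrite <- R, refl_dist; auto. }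
destruct (SS_or_OS Na Nb) as [?|O]; auto. exfalso.
apply (@inside_beyond a d b c); auto.
apply (@inside_of_side o w); auto. apply (@OS_OS o w a b c); auto.
Qed.

(* The image b' of b under pr q is also the mirror image of d in the perpendicular of
   aq at q, so the line db' does not meet aq and therefore separates q from c. *)
Lemma bisector_foot_side a b c d o q : ~ L a b c -> len a d = len a b -> Z a d c ->
  Z b q c -> len q b = len q d -> Z b o c -> len o b = len o c -> Z b q o.
Proof.
intros N E H Hq Eq Ho Eo. zneq.
assert (aq : a <> q) by (intros ->; apply N; col).
assert (bd : b <> d) by (intros ->; apply N; col).
assert (Et : refl a q b = d) by (apply refl_eq; auto).
destruct (Rt_erect aq) as [w R].
assert (qw : q <> w) by apply R.
set (b' := pr q b).
assert (Eb : refl q w d = b').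
{ unfold b'. rewrite (pr_comp _ (Rt_sym R)). f_equal.
  rewrite (@refl_line a q q a) by (auto; col). auto. }
assert (Zb' := pr_Z (o:=q) (x:=b) ltac:(auto)). fold b' in Zb'. zneq.
assert (Nd : ~ L q w d).
{ intros Q. rewrite (refl_on Q) in Eb. apply N.
  assert (L q b d) by (rewrite Eb; col). assert (L b c d) by col2. col2. }
assert (Nad : ~ L a q d).
{ intros Q. apply bd. rewrite <- (@refl_invol a q b aq), Et. apply refl_on; auto. }
assert (Naw : ~ L q w a) by (intros Q; apply (Rt_noncol R); col).
assert (Ea : refl q w a = pr q a) by (apply (Rt_refl_pr R); col).
assert (Za := pr_Z aq). zneq.
assert (D : forall z, L a q z -> ~ L d b' z).
{ intros z Lz Q. apply Nad.
  assert (L a (refl q w a) d).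
  { apply (@perpendiculars_eq q w a d z); auto.
    - rewrite Ea. col2.
    - rewrite Eb. auto. }
  rewrite Ea in *. col2. }
assert (db : d <> b').
{ intros Q. apply (refl_off Nd). congruence. }
assert (Da : ~ L d b' a) by (apply D; col). assert (Dq : ~ L d b' q) by (apply D; col).
assert (Oac : OS d b' a c) by (apply (@OS_of_Z d b' a d c); auto; col).
assert (Saq : SS d b' a q).
{ destruct (SS_or_OS Da Dq) as [?|[_ [_ [z [Lz Zz]]]]]; auto.
  destruct (D z); auto. col. }
assert (Zc : Z q b' c).
{ apply (@Z_of_OS d b').
  - apply OS_sym, (@OS_SS d b' c a q); auto. apply OS_sym; auto.
  - col.
  - col2. }
assert (Ec : pr o b = c) by (apply pr_eq; auto).
assert (qo : q <> o).
{ intros Q. subst o. fold b' in Ec. rewrite Ec in Zc. exact (Z_neq23 Zc eq_refl). }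
(* If o came before q, then by [pr_mono] c = [pr o b] would come before b' = [pr q b], but b' is
   between q and c. *)
assert (Nz : ~ Z b o q).
{ intros Q. apply pr_mono in Q. rewrite Ec in Q. fold b' in Q.
  ord b c (b :: q :: c :: b' :: nil). }
ord b c (b :: q :: c :: o :: nil).
Qed.

(** The line as is the axis taking b to d and meets bc in a point q. By [apex_side] and
    [bisector_foot_side] both a and q are on the side of b of the perpendicular bisector of bc, and
    s is between them. *)
Lemma cevian_side a b c d m s o w : ~ L a b c -> Z a m c ->
  len a d = len a b -> Z a d c -> len s b = len s d -> Z b s m ->
  Z b o c -> len o b = len o c -> Rt b o w -> SS o w s b.
Proof.
intros N Hm E Hd Es Hs Ho Eo R. zneq.
assert (ow : o <> w) by apply R.
assert (Erb : refl o w b = c).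
{ rewrite (Rt_refl_pr R) by col. apply pr_eq; auto. }
assert (Sa := apex_side N E Hd Erb ow).
assert (Nbm : ~ L b m a) by (intros Q; apply N; col2).
assert (as_ : a <> s) by (intros ->; apply Nbm; col).
assert (Nab : ~ L a s b) by (intros Q; apply Nbm; col2).
assert (Obm : OS a s b m) by (apply (@OS_of_Z a s b s m); auto; col).
assert (Smc : SS a s m c).
{ apply (@SS_ray a s a m c); auto; try col; [apply Obm|].
  zno. }
destruct (OS_SS Obm Smc) as [_ [Nc [q [Lq Zq]]]]. zneq.
assert (bd : b <> d) by (intros ->; apply N; col).
assert (Zaq : Z a s q).
{ assert (O1 : OS b m a c) by (apply (@OS_of_Z b m a m c); auto; col).
  assert (S1 : SS b m c q).
  { apply (@SS_ray b m b c q); auto; try col; [apply O1|].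
    zno. }
  apply (@Z_of_OS b m); [apply (OS_SS O1 S1)|col|col]. }
zneq.
assert (Eq : len q b = len q d) by (apply (@equidistant_extend a s); auto).
assert (Zqo := bisector_foot_side N E Hd Zq Eq Ho Eo).
assert (Sq : SS o w b q).
{ apply (@SS_ray o w o b q); auto; try col; zneq; auto.
  - apply (SS_r Sa).
  - zno. }
apply SS_sym. apply (@SS_trans o w b a); auto using SS_sym.
apply (@SS_between o w a s q); auto. apply (SS_trans Sa Sq).
Qed.

(** Hinge argument: cn is mirrored to bn', with bn' = bm, and bn' passes through the point j where
    sc meets the mirror. The axis through b exchanging n' and m separates s from j, hence from c. So
    cn' = bn is smaller than cm. *)
Lemma inside_reflected b c m n s o w : o <> w -> refl o w b = c -> SS o w s b ->
  Z b s m -> Z c s n -> len b m = len c n -> ~ L b s c -> inside c m (refl o w n).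
Proof.
intros ow Eb Ss Hm Hn E N.
assert (Nb := SS_r Ss). assert (Obc := refl_OS ow Nb). rewrite Eb in Obc.
set (r := refl o w) in *. assert (Mr : motion r) by (apply motion_refl; auto).
assert (Ec : r c = b) by (rewrite <- Eb; apply refl_invol; auto).
assert (Osc : OS o w c s) by (apply (@OS_SS o w c b s); auto using OS_sym, SS_sym).
destruct Osc as [_ [_ [j [Lj Zj]]]]. apply Z_sym in Zj.
assert (rj : r j = j) by (apply refl_on; auto).
assert (Zn : Z b (r s) (r n)) by (rewrite <- Ec; apply Mr; auto).
assert (Zj' : Z b j (r s)) by (rewrite <- Ec, <- rj; apply Mr, Z_sym; auto).
destruct (Z_trans1 Zj' Zn) as [_ Zjn]. set (n' := r n) in *. zneq.
assert (nm : n' <> m).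
{ intros Q. rewrite Q in Zjn. apply N. assert (L b j s) by col2. col2. }
assert (En : len b n' = len b m) by (rewrite E, <- Ec; apply (motion_isometry Mr)).
destruct (@bisector b n' m) as [t [bt Et]]; auto.
assert (Nn : ~ L b t n') by (intros Q; rewrite (refl_on Q) in Et; auto).
assert (Onm : OS b t n' m) by (rewrite <- Et; apply refl_OS; auto).
assert (Snj : SS b t n' j).
{ apply (@SS_ray b t b n' j); auto; try col. zno. }
assert (Sms : SS b t m s).
{ apply (@SS_ray b t b m s); auto; try col; [apply Onm|].
  zno. }
assert (Osj : OS b t s j).
{ apply OS_sym. apply (OS_SS (y:=m)); auto. apply OS_sym, (OS_SS (y:=n')); auto using OS_sym. }
pose proof Osj as [Nst [_ [z [Lz Zz]]]].
destruct (Z_trans1 Zz Zj) as [_ Zsc].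
assert (Ocs : OS b t s c) by (apply (@OS_of_Z b t s z c); auto).
apply (@inside_of_side b t).
- rewrite <- Et. apply refl_invol; auto.
- apply (@SS_trans b t c j).
  + apply (@OS_OS b t c s j); auto using OS_sym.
  + apply SS_sym; auto.
Qed.

(* A glide taking b to c and m to n, composed of the reflection in nw and pr p, is also
   h o pr u, where h is a reflection; as h exchanges the lines bm and cn, it
   fixes their intersection s. *)
Lemma glide_mirror b c m n s p w : n <> w -> n = pr p m -> refl n w (pr p b) = c ->
  b <> m -> ~ L b m c -> Z b s m -> Z c s n ->
  exists h v, motion h /\ (forall x, h (h x) = x) /\ h s = s /\
    (forall x, L b m x -> L c n (h x)) /\ (forall x, L c n x -> L b m (h x)) /\
    L c n v /\ (forall x, pr v (h x) = refl n w (pr p x)).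
Proof.
intros nw En Ec bm N Hs Hn. zneq.
(* Fl is the perpendicular to nw through p, the axis of the glide; when p is on nw it must be
   erected at p. *)
assert (G : exists F l, L n w F /\ F <> l /\ L F l p /\
  forall x, L n w x -> x <> F -> Rt x F l).
{ destruct (classic (L n w p)) as [K|K].
  - destruct (other_point nw K) as [e [Le ep]].
    destruct (Rt_erect ep) as [l R]. exists p, l. repeat split; auto; try apply R; try col.
    all: intros; assert (R' : Rt x p l) by (apply (@Rt_extend e); auto; col2); apply R'.
  - destruct (foot_ex nw K) as [F [LF [Fp R]]]. exists F, p. repeat split; auto; try col.
    all: intros; apply R; auto. }
destruct G as [F [l [LF [Fl [Lp RF]]]]].
set (r := refl F l). assert (Mr : motion r) by (apply motion_refl; auto).
assert (Ealpha : forall x, refl n w x = r (pr F x)).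
{ destruct (other_point nw LF) as [e [Le eF]]. intros x.
  assert (R := RF e Le eF). rewrite (pr_comp x (Rt_sym R)). unfold r.
  rewrite refl_invol; auto. symmetry. apply refl_line; auto. }
assert (Tm : r (pr F (pr p m)) = n).
{ rewrite <- Ealpha, <- En. apply refl_on. col. }
assert (Tb : r (pr F (pr p b)) = c) by (rewrite <- Ealpha; auto).
assert (LFl : L F l F) by col.
assert (Flip : forall x, ~ L F l x -> OS F l x (r (pr F (pr p x)))).
{ intros x Nx. assert (O1 := pr_OS Fl Lp Nx).
  assert (N1 : ~ L F l (pr p x)) by apply O1.
  assert (O2 := pr_OS Fl LFl N1).
  assert (N2 : ~ L F l (pr F (pr p x))) by apply O2.
  apply OS_sym, (@OS_SS F l _ (pr F (pr p x))).
  - apply OS_sym, refl_OS; auto.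
  - apply SS_sym, (OS_OS O1 O2). }
(* The glide exchanges the sides of its axis. If b and m were on one side, c and n would be on the
   other, although s lies between both pairs. *)
assert (U : exists u, L F l u /\ L b m u).
{ destruct (classic (L F l m)) as [Km|Km]; [exists m; split; auto; col|].
  destruct (classic (L F l b)) as [Kb|Kb]; [exists b; split; auto; col|].
  destruct (SS_or_OS Kb Km) as [S|[_ [_ [u [Lu Zu]]]]].
  2:{ exists u. split; auto. col. }
  exfalso. assert (Om := Flip m Km). assert (Ob := Flip b Kb). rewrite Tm in Om.
  rewrite Tb in Ob.
  assert (Sbs : SS F l b s) by (apply (SS_between S Hs)).
  assert (Scn : SS F l c n).
  { apply SS_sym. apply (@OS_OS F l n m c); [apply OS_sym; auto|].
    apply OS_sym, (@OS_SS F l c b m); auto using OS_sym. }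
  assert (Scs : SS F l c s) by (apply (SS_between Scn Hn)).
  apply (OS_not_SS Ob). apply (SS_trans Sbs (SS_sym Scs)). }
destruct U as [u [Lu Lbu]].
(* [pr F] after [pr p] equals [pr e] after [pr u]. Hence h, which is [pr e] followed by r, is the
   reflection in the perpendicular to the axis at e. *)
destruct (three_points Fl LFl Lp Lu) as [e [Le Ee]].
set (h := fun x => r (pr e x)).
assert (Mh : motion h) by exact (motion_comp Mr (motion_pr e)).
assert (re : r e = e) by (apply refl_on; auto).
assert (hh : forall x, h (h x) = x).
{ intros x. unfold h at 1. rewrite (pr_conj e (h x) Mr), re.
  unfold h, r. rewrite refl_invol; auto. apply pr_invol. }
set (tau := fun x => refl n w (pr p x)).
assert (Mt : motion tau) by exact (motion_comp (motion_refl nw) (motion_pr p)).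
assert (Et : forall x, tau x = h (pr u x)).
{ intros x. unfold tau, h. rewrite Ealpha, <- (pr_invol u x) at 1. rewrite Ee. reflexivity. }
assert (tb : tau b = c) by exact Ec.
assert (tm : tau m = n) by (unfold tau; rewrite <- En; apply refl_on; col).
assert (L1 : forall x, L b m x -> L c n (h x)).
{ intros x Lx. rewrite <- (pr_invol u x), <- Et, <- tb, <- tm.
  apply (motion_L _ _ _ Mt). apply pr_col; auto. }
assert (L2 : forall x, L c n x -> L b m (h x)).
{ intros x Lx.
  assert (Q : tau (pr u (h x)) = x) by (rewrite Et, pr_invol; apply hh).
  rewrite <- Q, <- tb, <- tm in Lx. rewrite (motion_L _ _ _ Mt) in Lx.
  apply (pr_col bm Lbu) in Lx. rewrite pr_invol in Lx. exact Lx. }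
assert (hs : h s = s).
{ apply NNPP. intros Q. apply N.
  assert (A1 : L b m (h s)) by (apply L2; col).
  assert (A2 : L c n (h s)) by (apply L1; col).
  assert (A3 : L s (h s) c) by col2. assert (A4 : L s (h s) b) by col2.
  assert (A5 : L s (h s) m) by col2. assert (Q' : s <> h s) by auto. col2. }
exists h, (h u). repeat split; auto; try apply Mh.
intros x. fold (tau x). rewrite Et, (pr_conj u x Mh). reflexivity.
Qed.

(* [pr s (h b)] is the point of the ray sc at distance sb from s. *)
Lemma copied_point b c m n s o v w h : o <> w -> refl o w b = c -> SS o w s b ->
  ~ L b s c -> Z b s m -> Z c s n -> motion h -> (forall x, h (h x) = x) -> h s = s ->
  (forall x, L b m x -> L c n (h x)) -> L c n v ->
  pr v (h b) = c -> pr v (h m) = n -> Z s (pr s (h b)) c.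
Proof.
intros ow Eb Ss N Hm Hn Mh hh hs L1 Lv Vb Vm. zneq.
assert (cn : c <> n) by auto.
set (b1 := h b) in *. set (m1 := h m) in *. set (d1 := pr s b1).
assert (Lb1 : L c n b1) by (apply L1; col). assert (Lm1 : L c n m1) by (apply L1; col).
assert (Z1 : Z b1 s m1) by (rewrite <- hs; apply Mh; auto).
assert (sb1 : b1 <> s) by apply (Z_neq12 Z1).
assert (Zd : Z b1 s d1) by (apply pr_Z; auto).
(* [pr v] reverses the order on cn and takes [b1], [m1] to c, n, while s separates both pairs. *)
assert (Z2 : Z b1 s c).
{ zneq. destruct (@lt_total c n b1 m1) as [Q|Q]; auto; assert (Q' := Q);
    apply (@pr_anti c n v) in Q'; auto; rewrite Vb, Vm in Q';
    ord c n (b1 :: m1 :: c :: n :: s :: nil). }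
zneq.
assert (Ed : len s d1 = len s b).
{ unfold d1. rewrite pr_len. unfold b1. rewrite <- hs at 1. apply (motion_isometry Mh). }
assert (dc : d1 <> c).
{ intros Q. rewrite Q in Ed. assert (bc : b = c); [|rewrite <- bc in N].
  - apply (@equidistant_3 o w s); auto; [apply (SS_l Ss)| |].
    + rewrite <- Eb, refl_dist; auto. col.
    + rewrite <- Eb, refl_dist; auto. col.
  - apply N. col. }
destruct (@L_cases s d1 c) as [Q|[Q|Q]]; auto; try col2.
(* If c came first, the motion k would carry c to a point between s and b at distance sc from s,
   whereas b is inside the circle around s through c. *)
- exfalso. apply Z_sym in Q.
  set (k := fun x => pr s (h x)).
  assert (Mk : motion k) by exact (motion_comp (motion_pr s) Mh).
  assert (ks : k s = s) by (unfold k; rewrite hs; apply pr_o).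
  assert (kd : k d1 = b).
  { unfold k, d1. rewrite (pr_conj s b1 Mh), hs. unfold b1. rewrite hh. apply pr_invol. }
  assert (Q' : Z s (k c) b) by (rewrite <- ks, <- kd; apply Mk; auto).
  revert Q'. apply (@inside_beyond s (k c) c b); auto.
  + rewrite <- ks at 1. intros G. apply (isometry_inj (motion_isometry Mk)) in G. auto.
  + rewrite <- ks at 1. apply (motion_isometry Mk).
  + apply (@inside_of_side o w); auto. rewrite <- Eb. apply refl_invol; auto.
- exfalso. exact (between_opposite_excl Zd Z2 (Z_sym Q)).
Qed.

(* The line through k b and k n touches the circle around s that touches ab and ac. *)
Lemma tangent_meets a b c d m n s h (k := fun x => pr s (h x)) : ~ L a b c ->
  Z a m c -> Z a n b -> len a d = len a b -> Z a d c -> len s b = len s d ->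
  Z b s m -> Z c s n -> motion h -> (forall x, h (h x) = x) -> h s = s ->
  Z s (k b) c -> ~ L s c (k n) -> exists y, L (k b) (k n) y /\ L a c y /\ y <> c /\ ~ Z y c m.
Proof.
intros N Hm Hn Ead Hd Es Hbs Hcs Mh hh hs Zd Nn. zneq.
assert (Mk : motion k) by exact (motion_comp (motion_pr s) Mh).
assert (ks : k s = s) by (unfold k; rewrite hs; apply pr_o).
set (d1 := k b) in *. set (n2 := k n) in *.
assert (Ns : ~ L a c s) by (intros Q; apply N; assert (L m s a) by col2;
  assert (L m c s) by col2; assert (L m b a) by col2; col2).
assert (as_ : a <> s) by (intros <-; apply Ns; col).
assert (bd : b <> d) by (intros <-; apply N; col).
set (t := refl a s). assert (Mt : motion t) by (apply motion_refl; auto).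
assert (tb : t b = d) by (apply refl_eq; auto).
assert (td : t d = b) by (rewrite <- tb; apply refl_invol; auto).
assert (ta : t a = a) by (apply refl_on; col).
assert (ts : t s = s) by (apply refl_on; col).
(* t takes ac to ab, so the motion g fixes s and takes ac to the line [d1] [n2], foot of s to foot
   of s. *)
set (g := fun x => k (t x)). assert (Mg : motion g) by exact (motion_comp Mk Mt).
assert (gs : g s = s) by (unfold g; rewrite ts; auto).
assert (gd : g d = d1) by (unfold g; rewrite td; auto).
assert (d1n2 : d1 <> n2).
{ intros Q. apply (isometry_inj (motion_isometry Mk)) in Q. auto. }
assert (Lg : forall x, L a c x -> L d1 n2 (g x)).
{ intros x Lx. apply (motion_L b n (t x) Mk).
  assert (L a b (t x)) by (rewrite <- ta, <- td; apply (motion_L a d x Mt); col2). col2. }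
assert (ac : a <> c) by auto.
destruct (foot_ex ac Ns) as [f [Lf [fs Rf]]].
assert (Ed1 : len s d1 = len s d).
{ rewrite <- gd, <- gs at 1. apply (motion_isometry Mg). }
assert (sd1 : s <> d1) by auto.
(* c lies outside the circle around s through d, being beyond [d1]. If f were c or beyond c as seen
   from d, then c would be on a chord, or its far end. *)
assert (F : f <> c /\ ~ Z d c f).
{ assert (A : forall u, Z d c u -> len s u <> len s d).
  { intros u Zu Eu. apply (@inside_beyond s d1 d c); auto.
    apply (@inside_chord s d u c); auto. }
  assert (B : d <> f -> len s (pr f d) = len s d).
  { intros df. apply len_pr_foot. right. split; auto. intros. apply Rf; auto. col. }
  split.
  - intros ->. apply (A (pr c d)); [apply pr_Z|apply B]; auto.
  - intros Q. zneq. apply (A (pr f d)); [|apply B; auto].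
    apply (Z_trans1 Q). apply pr_Z. auto. }
destruct F as [fc Zf].
assert (Ns' : ~ L d1 n2 s).
{ destruct (classic (f = d)) as [->|fd].
  - intros Q. assert (R := Rt_motion Mg (Rf a ltac:(col) ltac:(auto))).
    rewrite gs, gd in R. apply (Rt_noncol R).
    assert (L d1 n2 (g a)) by (apply Lg; col). col2.
  - intros Q. assert (R := Rt_motion Mg (Rf d ltac:(col) ltac:(auto))).
    rewrite gs, gd in R. apply (Rt_noncol R).
    assert (L d1 n2 (g f)) by (apply Lg; auto). col2. }
destruct (other_point ac Lf) as [x [Lx xf]].
assert (Rg := Rt_motion Mg (Rf x Lx xf)). rewrite gs in Rg.
assert (Lgf := Lg f Lf). assert (Lgx := Lg x Lx).
assert (gfx : g f <> g x) by (intros Q; apply (isometry_inj (motion_isometry Mg)) in Q; auto).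
assert (Egf : len s f = len s (g f)) by (rewrite <- gs at 2; symmetry; apply (motion_isometry Mg)).
assert (ffg : f <> g f).
{ intros Q. rewrite <- Q in *.
  assert (L f x (g x)) by (apply (@Rt_unique s); apply Rt_sym; auto).
  assert (L a c (g x)) by (apply (@L_line f x); auto; apply (@L_line a c); auto; col).
  assert (L f (g x) d1) by (apply (@L_line d1 n2); auto; col).
  assert (L f (g x) a) by (apply (@L_line a c); auto; col).
  assert (L f (g x) c) by (apply (@L_line a c); auto; col).
  assert (L a c d1) by col2.
  zneq. apply Ns. apply (@L_line c d1); auto; apply (@L_line a c); auto; col. }
(* f is on the circle touched by [d1] [n2] at g f, so on the side of s; c is across. The crossing y
   of fc is therefore on the ray from c through m. *)
assert (Ssf : SS d1 n2 s f).
{ apply (@SS_line (g f) (g x)); auto.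
  - apply (@L_line d1 n2); auto; col.
  - apply (@L_line d1 n2); auto; col.
  - apply tangent_side; auto. apply Rt_sym; auto. }
zneq.
assert (Osc : OS d1 n2 s c) by (apply (@OS_of_Z d1 n2 s d1 c); auto; col).
assert (Ofc : OS d1 n2 f c) by (apply OS_sym, (@OS_SS d1 n2 c s f); auto using OS_sym).
destruct Ofc as [_ [_ [y [Ly Zy]]]]. exists y. zneq.
assert (Lac : L a c y) by col2.
repeat split; auto. ord a c (a :: c :: d :: m :: f :: y :: nil).
Qed.

(* With b' = pr p b, the angle nb'm equals abm, which exceeds acn; so m is nearer to c
   than to b'. *)
Lemma parallelogram_side a b c d m n s p o w w' : ~ L a b c ->
  Z a m c -> Z a n b -> len a d = len a b -> Z a d c -> len s b = len s d ->
  Z b s m -> Z c s n -> Z m p n -> len p m = len p n -> 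
  o <> w' -> refl o w' b = c -> SS o w' s b ->
  n <> w -> refl n w (pr p b) = c -> pr p b <> c -> SS n w c m.
Proof.
intros N Hm Hn Ead Hd Es Hbs Hcs Hp Ep ow Eb Ss nw Ec b'c. zneq.
assert (En : n = pr p m) by (symmetry; apply pr_eq; auto).
assert (bm : b <> m) by auto. assert (cn : c <> n) by auto. assert (ac : a <> c) by auto.
assert (Nbmc : ~ L b m c) by (intros Q; apply N; col2).
assert (Nbsc : ~ L b s c) by (intros Q; apply Nbmc; col2).
assert (Nm : ~ L c n m) by (intros Q; apply Nbmc; assert (L c s m) by col2; col2).
assert (Nb : ~ L c n b) by (intros Q; apply Nbsc; col2).
destruct (glide_mirror nw En Ec bm Nbmc Hbs Hcs)
  as [h [v [Mh [hh [hs [L1 [L2 [Lv Ev]]]]]]]].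
assert (Vb : pr v (h b) = c) by (rewrite Ev; auto).
assert (Vm : pr v (h m) = n).
{ rewrite Ev, <- En. apply refl_on. col. }
assert (Zd1 := copied_point ow Eb Ss Nbsc Hbs Hcs Mh hh hs L1 Lv Vb Vm).
set (d1 := pr s (h b)) in *. set (n2 := pr s (h n)).
assert (Hnh : L b m (h n)) by (apply L2; col).
assert (hns : h n <> s).
{ intros Q. rewrite <- hs in Q. apply (isometry_inj (motion_isometry Mh)) in Q. auto. }
assert (Zn2 : Z (h n) s n2) by (apply pr_Z; auto).
assert (Lbs : L b m s) by col.
assert (Ln2 : L b m n2) by (apply pr_col; auto).
assert (Nn2 : ~ L c n n2).
{ intros Q. apply Nm. zneq. assert (L s n2 c) by col2. assert (L s n2 n) by col2.
  assert (L s n2 m) by col2. col2. }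
assert (Nn2' : ~ L s c n2) by (intros Q; apply Nn2; col2).
destruct (@tangent_meets a b c d m n s h) as [y [Ly1 [Ly2 [yc Zy]]]]; auto.
fold d1 n2 in Ly1. zneq.
assert (Lcd1 : L c n d1) by col2. assert (Lcs : L c n s) by col.
(* This moves the copied angle abm from [d1] to the vertex c: [pr e] takes [d1] to c and the point
   [n3] of the line [d1] [n2] to the mirror image m' of m. *)
destruct (three_points cn Lv Lcs Lcd1) as [e [Le Ee]].
assert (Ed1 : pr e d1 = c).
{ rewrite <- Ee, pr_o. unfold d1. rewrite pr_invol. exact Vb. }
assert (Em : pr e (pr d1 n2) = refl n w m).
{ rewrite <- Ee, pr_invol. unfold n2. rewrite pr_invol, Ev, En, pr_invol. auto. }
set (m' := refl n w m) in *. set (n3 := pr d1 n2) in *.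
assert (d1n2 : d1 <> n2) by (intros Q; apply Nn2; rewrite <- Q; auto).
assert (Zn3 : Z n2 d1 n3) by (apply pr_Z; auto).
assert (ed1 : e <> d1).
{ intros Q. rewrite Q, pr_o in Ed1. zneq. auto. }
assert (Ne : ~ L d1 n2 e) by (intros Q; apply Nn2; col2).
(* A point reflection takes a line missing its centre to a disjoint line. *)
assert (D : forall z, L d1 n2 z -> ~ L c m' z).
{ intros z Lz Q. zneq.
  rewrite <- Ed1, <- Em, <- (pr_invol e z) in Q. rewrite (motion_L _ _ _ (motion_pr e)) in Q.
  assert (Lz' : L d1 n2 (pr e z)) by col2.
  destruct (classic (z = e)) as [->|ze]; auto.
  apply Ne. assert (Ze := pr_Z ze). zneq. col2. }
assert (Nc : ~ L n w c).
{ intros Q. apply b'c. rewrite <- (refl_invol (pr p b) nw), Ec. apply refl_on; auto. }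
destruct (classic (L n w m)) as [K|K].
{ exfalso. apply (D y Ly1). unfold m'. rewrite (refl_on K). col2. }
(* If the mirror separated c from m, then m' would fall inside the angle acn, although the angle
   ncm' equals abm. *)
destruct (SS_or_OS Nc K) as [?|[_ [_ [x [Lx Zx]]]]]; auto. exfalso.
assert (Zx' : Z (pr p b) x m').
{ rewrite <- (refl_on Lx). replace (pr p b) with (refl n w c).
  - apply (motion_refl nw). exact Zx.
  - rewrite <- Ec. apply refl_invol; auto. }
assert (Nacn : ~ L a c n) by (intros Q; apply N; col2).
assert (pr_n : pr p n = m) by (rewrite En; apply pr_invol).
(* [pr p] takes n between a and b to m between [pr p a] and [pr p b], and [pr p a] is on the side of
   n. *)
assert (Onb : OS a c n (pr p b)).
{ assert (S1 : SS a c n p).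
  { apply (@SS_ray a c m n p); auto; try col. zno. }
  assert (ap : a <> p) by (intros <-; apply (SS_r S1); col).
  assert (Za := pr_Z ap). zneq.
  assert (S2 : SS a c p (pr p a)).
  { apply (@SS_ray a c a p (pr p a)); auto; try col; [apply (SS_r S1)|zno]. }
  assert (Zb : Z (pr p a) m (pr p b)) by (rewrite <- pr_n; apply (motion_pr p); auto).
  apply OS_sym, (@OS_SS a c _ (pr p a)).
  - apply OS_sym, (@OS_of_Z a c _ m); auto; [apply (SS_r S2)|col].
  - apply SS_sym, (SS_trans S1 S2). }
assert (Snm : SS a c n m').
{ apply (OS_OS Onb). apply (@OS_of_Z a c _ x); auto.
  - apply (SS_r (SS_refl (proj1 (OS_sym Onb)))).
  - zneq. col2. }
assert (Sm2 : SS c n n2 m).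
{ assert (Zhn : Z (h c) s (h n)) by (rewrite <- hs; apply Mh; auto).
  assert (Zhb : Z b s (h c)).
  { assert (Zb1 : Z (h b) s c).
    { assert (b1s : h b <> s).
      { intros Q. rewrite <- hs in Q. apply (isometry_inj (motion_isometry Mh)) in Q. auto. }
      assert (Q := pr_Z b1s). fold d1 in Q.
      assert (Lhb : L c n (h b)) by (apply L1; col). clear - Q Zd1 Lhb cn Hcs HP Lcd1.
      zneq. ord c n (c :: n :: s :: d1 :: h b :: nil). }
    rewrite <- hs, <- (hh b). apply Mh. exact Zb1. }
  assert (Lhc : L b m (h c)) by (apply L2; col).
  apply (@SS_ray c n s n2 m); auto; try col2.
  zneq. clear - Zhb Zhn Zn2 Hbs Lhc Hnh Ln2 bm HP.
  zneq. ord b m (b :: m :: s :: h c :: h n :: n2 :: nil). }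
assert (Sm' : SS c n m' y).
{ apply (@SS_trans c n m' m).
  - apply (@SS_trans c n m' n2); auto. apply SS_sym. rewrite <- Em.
    apply (@OS_OS c n n2 n3); [apply pr_OS; auto|].
    apply pr_OS; auto. apply (pr_OS cn Lcd1 Nn2).
  - apply (@SS_ray c n c m y); auto; try col2. intros Q; apply Zy, Z_sym; auto. }
assert (Sd1 : SS c y m' d1).
{ apply (@SS_line a c c y); auto; try col.
  apply (@SS_trans a c m' n); auto using SS_sym.
  apply (@SS_ray a c c n d1); auto; try col2. clear - Zd1 Hcs HP.
  zneq. intros Q. assert (cs : c <> s) by auto. ord c s (c :: s :: n :: d1 :: nil). }
(* Being inside the angle, the line cm' must cross the segment from [d1] to y, which lies on [d1]
   [n2]; [D] forbids it. *)
assert (O : OS c m' d1 y).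
{ apply crossbar; auto. apply (@SS_line c n c d1); auto; col. }
destruct O as [_ [_ [z [Lz Zz]]]]. apply (D z); auto. zneq. col2.
Qed.

(** [I1] says bn < cm, [I2] says cm < b'm = bn. Both are put on circles around c, where [n'] and
    [refl n w m] have the same distance bn from c, so that [inside_antisym] applies. *)
Lemma not_shorter a b c d m n s p o : ~ L a b c ->
  Z a m c -> Z a n b -> len a d = len a b -> Z a d c -> len s b = len s d ->
  Z b s m -> Z c s n -> len b m = len c n ->
  Z m p n -> len p m = len p n -> Z b o c -> len o b = len o c -> False.
Proof.
intros N Hm Hn Ead Hd Es Hbs Hcs Ebm Hp Ep Ho Eo. zneq.
assert (bo : b <> o) by auto. destruct (Rt_erect bo) as [w' R].
assert (ow : o <> w') by apply R.
assert (Eb : refl o w' b = c).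
{ rewrite (Rt_refl_pr R) by col. apply pr_eq; auto. }
assert (Ss := cevian_side N Hm Ead Hd Es Hbs Ho Eo R).
assert (Nbmc : ~ L b m c) by (intros Q; apply N; col2).
assert (Nbsc : ~ L b s c) by (intros Q; apply Nbmc; col2).
assert (I1 := inside_reflected ow Eb Ss Hbs Hcs Ebm Nbsc).
set (n' := refl o w' n) in *.
assert (En : n = pr p m) by (symmetry; apply pr_eq; auto).
assert (En' : m = pr p n) by (rewrite En, pr_invol; auto).
set (b' := pr p b).
assert (Ip := motion_isometry (motion_pr p)).
assert (E1 : len n b' = len n c).
{ unfold b'. rewrite En at 1. rewrite Ip. cg. }
assert (nb' : n <> b').
{ intros Q. rewrite En in Q. apply (isometry_inj Ip) in Q. auto. }
(* Otherwise p would be on bc, but p lies between m and n, which are both on the side of a. *)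
assert (b'c : b' <> c).
{ intros Q. assert (bc : b <> c) by (intros ->; apply N; col).
  assert (Na : ~ L b c a) by (intros G; apply N; col).
  assert (Sm : SS b c a m) by (apply (@SS_ray b c c a m); auto; try col; zno).
  assert (Sn : SS b c a n) by (apply (@SS_ray b c b a n); auto; try col; zno).
  assert (Sp := SS_between (SS_trans (SS_sym Sm) Sn) Hp).
  apply (SS_r Sp). assert (K := pr_L p b). fold b' in K. rewrite Q in K. col. }
destruct (@bisector n b' c) as [w [nw Ec]]; auto.
assert (S := parallelogram_side N Hm Hn Ead Hd Es Hbs Hcs Hp Ep ow Eb Ss nw Ec b'c).
assert (I2 : inside c (refl n w m) m).
{ apply (@inside_of_side n w); auto. apply refl_invol; auto. }
assert (F1 : len c n' = len b n).
{ rewrite <- Eb. apply refl_isometry; auto. }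
assert (F2 : len c (refl n w m) = len b n).
{ rewrite <- Ec, (refl_isometry nw). unfold b'. rewrite En' at 1. apply Ip. }
assert (cm : c <> m) by auto. assert (bn : b <> n) by auto.
assert (cn' : c <> n').
{ intros Q. apply bn. apply (@len_eq b n c). rewrite <- F1, <- Q. reflexivity. }
apply (inside_antisym cm cn' I1).
apply (@inside_len c (refl n w m) n'); auto. congruence.
Qed.

(** The reflection t in as takes d to b, hence c to a point between a and b at distance ac from a;
    this point replaces d in the configuration with b and c, m and n exchanged. *)
Lemma not_longer a b c d m n s p o : ~ L a b c ->
  Z a m c -> Z a n b -> len a d = len a b -> Z a c d -> len s b = len s d ->
  Z b s m -> Z c s n -> len b m = len c n ->
  Z m p n -> len p m = len p n -> Z b o c -> len o b = len o c -> False.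
Proof.
intros N Hm Hn Ead Hd Es Hbs Hcs Ebm Hp Ep Ho Eo. zneq.
assert (as_ : a <> s) by (intros <-; apply N; col2).
assert (bd : b <> d) by (intros <-; apply N; col).
set (t := refl a s). assert (Mt : motion t) by (apply motion_refl; auto).
assert (ta : t a = a) by (apply refl_on; col).
assert (ts : t s = s) by (apply refl_on; col).
assert (td : t d = b).
{ rewrite <- (refl_invol b as_). unfold t. f_equal. symmetry. apply refl_eq; auto. }
apply (@not_shorter a c b (t c) n m s p o); auto using Z_sym.
- intros Q. apply N. col.
- rewrite <- ta at 1. apply (motion_isometry Mt).
- rewrite <- ta, <- td. apply Mt. auto.
- rewrite <- ts at 2. symmetry. apply (motion_isometry Mt).
Qed.

End MetricPlane.

Theorem theorem1 (P : Type) (Z : P -> P -> P -> Prop)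
    (cong : P -> P -> P -> P -> Prop)
    (HP : standard_ordered_metric_plane Z cong)
    (a b c d m n s p o : P)
    (Habc : ~ L Z a b c)
    (Hm : Z a m c) (Hn : Z a n b)
    (Had : cong a d a b) (Hd : Z a d c \/ Z a c d \/ d = c)
    (Hsbd : cong s b s d) (Hbsm : Z b s m) (Hcsn : Z c s n)
    (Hbmcn : cong b m c n)
    (Hp : midpoint Z cong m p n) (Ho : midpoint Z cong b o c) :
  cong a b a c.
Proof.
destruct Hp as [Hp Ep], Ho as [Ho Eo].
apply (lenP HP) in Had, Hsbd, Hbmcn, Ep, Eo.
destruct Hd as [Hd|[Hd|<-]].
- destruct (not_shorter HP Habc Hm Hn Had Hd Hsbd Hbsm Hcsn Hbmcn Hp Ep Ho Eo).
- destruct (not_longer HP Habc Hm Hn Had Hd Hsbd Hbsm Hcsn Hbmcn Hp Ep Ho Eo).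
- apply (lenP HP). auto.
Qed.
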